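(* Let $d\ge2$ be an integer, let $f:\mathbb{N}\to\mathbb{N}$ be a function of subexponential growth, and let $\mathcal{P}\subset\mathrm{Graph}_d$ be a union-closed monotone graph property. Then $\zeta(G)=d_e(G,\mathcal{P})$ is a continuous graph parameter on $\mathrm{Graph}_d^f$; that is, $\lim_{n\to\infty}d_e(G_n,\mathcal{P})$ exists for every weakly convergent sequence $\{G_n\}_{n=1}^\infty\subset\mathrm{Graph}_d^f$.
   Context: $\mathrm{Graph}_d$ is the set of finite simple graphs (up to isomorphism) in which every vertex has degree at most $d$. For a vertex $x$ of a graph, $B_r(x)$ is the ball of radius $r$ around $x$ (the vertices at graph distance at most $r$ from $x$ with the induced graph structure, rooted at $x$). A function $f:\mathbb{N}\to\mathbb{N}$ has subexponential growth if for every $\delta>0$ there is $C_\delta>0$ such that $f(n)\le C_\delta(1+\delta)^n$ for all $n\ge1$. $\mathrm{Graph}_d^f$ is the class of graphs $G\in\mathrm{Graph}_d$ such that $|B_r(x)|\le f(r)$ for each $x\in V(G)$ and each $r\ge 1$. For $r\ge1$, $U^{r,d}$ is the finite set of rooted isomorphism classes of finite simple connected rooted graphs of maximum degree at most $d$ in which every vertex is at distance at most $r$ from the root. For $\alpha\in U^{r,d}$ and $G\in \mathrm{Graph}_d$, $p_G(\alpha)=|T(G,\alpha)|/|V(G)|$, where $T(G,\alpha)$ is the set of $x\in V(G)$ such that $B_r(x)$ is rooted isomorphic to $\alpha$. A sequence $\{G_n\}\subset\mathrm{Graph}_d$ with $|V(G_n)|\to\infty$ is weakly convergent if $\lim_{n\to\infty}p_{G_n}(\alpha)$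 exists for every $r\ge1$ and $\alpha\in U^{r,d}$. A graph parameter is a real function on finite simple graphs invariant under isomorphism; it is continuous on $\mathrm{Graph}_d^f$ if $\lim_{n\to\infty}\phi(G_n)$ exists for every weakly convergent sequence $\{G_n\}\subset\mathrm{Graph}_d^f$. A class $\mathcal{P}\subset\mathrm{Graph}_d$ is a union-closed monotone graph property if: (i) every $A$ with $|E(A)|=0$ belongs to $\mathcal{P}$; (ii) if $A\in\mathcal{P}$ and $B\subset A$ is a spanning subgraph ($V(B)=V(A)$), then $B\in\mathcal{P}$; (iii) if $A,B\in\mathcal{P}$, then the disjoint union of $A$ and $B$ is in $\mathcal{P}$. For finite graphs $G,H$ on the same vertex set $V$, $d_e(G,H)=|E(G)\triangle E(H)|/|V|$. The edit-distance from $\mathcal{P}$ is $d_e(G,\mathcal{P})=\inf\{d_e(G,H): V(H)=V(G),\ H\in\mathcal{P}\}$. *)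

(* Defs.v *)
From HB Require Import structures.
From mathcomp Require Import all_boot all_order all_algebra.
From mathcomp Require Import all_classical all_reals all_analysis.

Set Implicit Arguments.
Unset Strict Implicit.
Unset Printing Implicit Defensive.

Import Order.TTheory GRing.Theory Num.Theory.
Import numFieldNormedType.Exports.

Local Open Scope classical_set_scope.
Local Open Scope ring_scope.

Record sgraph (V : finType) := SGraph {
  adj : rel V;
  adj_sym : symmetric adj;
  adj_irr : irreflexive adj }.

Record fsgraph := FSGraph {
  vertex : finType;
  sgraph_of :> sgraph vertex }.

Definition edges (V : finType) (G : sgraph V) : {set {set V}} :=
  [set [set p.1; p.2]%SET | p : V * V & adj G p.1 p.2]%SET.

Definition degree (V : finType) (G : sgraph V) (x : V) : nat :=
  #|[set y | adj G x y]%SET|.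

Definition gconnected (V : finType) (G : sgraph V) : Prop :=
  forall x y : V, connect (adj G) x y.

Definition graph_iso (G H : fsgraph) : Prop :=
  exists2 h : vertex G -> vertex H, bijective h &
    forall x y, adj H (h x) (h y) = adj G x y.

(* Classes of graphs are predicates on [fsgraph]; isomorphism classes are
   handled through representatives. *)
Definition Graph_d (d : nat) (G : fsgraph) : Prop :=
  forall x : vertex G, (degree G x <= d)%N.

(* y is at distance at most r from x iff some walk x :: p of length
   [size p <= r] ends in y; [r.-bseq V] is the type of such sequences p. *)
Definition gball (V : finType) (G : sgraph V) (r : nat) (x : V) : {set V} :=
  [set y | [exists p : r.-bseq V, path (adj G) x p && (last x p == y)]]%SET.

Lemma gball_root (V : finType) (G : sgraph V) (r : nat) (x : V) :
  x \in gball G r x.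
Proof.
by rewrite inE; apply/existsP; exists (@Bseq r V [::] (leq0n r)); rewrite /= eqxx.
Qed.

Lemma induced_sym (V : finType) (G : sgraph V) (S : {set V}) :
  symmetric (fun u v : {x : V | x \in S} => adj G (val u) (val v)).
Proof. by move=> u v; rewrite adj_sym. Qed.

Lemma induced_irr (V : finType) (G : sgraph V) (S : {set V}) :
  irreflexive (fun u v : {x : V | x \in S} => adj G (val u) (val v)).
Proof. by move=> u; rewrite adj_irr. Qed.

Definition induced (V : finType) (G : sgraph V) (S : {set V}) :
    sgraph {x : V | x \in S} :=
  SGraph (@induced_sym V G S) (@induced_irr V G S).

Record rsgraph := RSGraph {
  fsgraph_of :> fsgraph;
  groot : vertex fsgraph_of }.

Definition rooted_iso (A B : rsgraph) : Prop :=
  exists2 h : vertex A -> vertex B, bijective h &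
    (forall x y, adj B (h x) (h y) = adj A x y) /\ h (groot A) = groot B.

Definition rooted_ball (G : fsgraph) (r : nat) (x : vertex G) : rsgraph :=
  @RSGraph (FSGraph (induced G (gball G r x)))
    (exist (fun y => y \in gball G r x) x (gball_root G r x)).

(* Representatives of the elements of U^{r,d}. *)
Definition U_rd (r d : nat) (A : rsgraph) : Prop :=
  [/\ gconnected A, Graph_d d A &
      forall x : vertex A, x \in gball A r (groot A)].

Definition T_set (G : fsgraph) (r : nat) (A : rsgraph) : {set vertex G} :=
  [set x | `[< rooted_iso (rooted_ball r x) A >]]%SET.

Definition p_stat (R : realType) (G : fsgraph) (r : nat) (A : rsgraph) : R :=
  #|T_set G r A|%:R / #|vertex G|%:R.

Definition weakly_convergent (R : realType) (d : nat) (G : nat -> fsgraph) :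
    Prop :=
  [/\ forall n, Graph_d d (G n),
      #|vertex (G n)| @[n --> \oo] --> \oo &
      forall (r : nat) (A : rsgraph), (1 <= r)%N -> U_rd r d A ->
        cvg ((p_stat R (G n) r A : R) @[n --> \oo])].

Definition subexponential (R : realType) (f : nat -> nat) : Prop :=
  forall delta : R, 0 < delta -> exists2 C : R, 0 < C &
    forall n : nat, (1 <= n)%N -> (f n)%:R <= C * (1 + delta) ^+ n.

Definition Graph_df (d : nat) (f : nat -> nat) (G : fsgraph) : Prop :=
  Graph_d d G /\
  forall (x : vertex G) (r : nat), (1 <= r)%N -> (#|gball G r x| <= f r)%N.

Definition graph_parameter (R : realType) (phi : fsgraph -> R) : Prop :=
  forall G H : fsgraph, graph_iso G H -> phi G = phi H.

Definition continuous_parameter (R : realType) (d : nat) (f : nat -> nat)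
    (phi : fsgraph -> R) : Prop :=
  graph_parameter phi /\
  forall G : nat -> fsgraph, (forall n, Graph_df d f (G n)) ->
    weakly_convergent R d G -> cvg (phi (G n) @[n --> \oo]).

Definition dunion_adj (V W : finType) (G : sgraph V) (H : sgraph W) :
    rel (V + W)%type :=
  fun u v => match u, v with
             | inl x, inl y => adj G x y
             | inr x, inr y => adj H x y
             | _, _ => false
             end.

Lemma dunion_sym (V W : finType) (G : sgraph V) (H : sgraph W) :
  symmetric (dunion_adj G H).
Proof. by move=> [x|x] [y|y] //=; rewrite adj_sym. Qed.

Lemma dunion_irr (V W : finType) (G : sgraph V) (H : sgraph W) :
  irreflexive (dunion_adj G H).
Proof. by move=> [x|x] /=; rewrite adj_irr. Qed.

Definition dunion (G H : fsgraph) : fsgraph :=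
  FSGraph (SGraph (@dunion_sym _ _ G H) (@dunion_irr _ _ G H)).

Record union_closed_monotone (d : nat) (P : fsgraph -> Prop) : Prop := {
  ucm_iso : forall A B : fsgraph, graph_iso A B -> P A -> P B;
  ucm_sub : forall A : fsgraph, P A -> Graph_d d A;
  ucm_edgeless : forall A : fsgraph, #|edges A| = 0%N -> P A;
  ucm_spanning : forall (V : finType) (A B : sgraph V),
    P (FSGraph A) -> edges B \subset edges A -> P (FSGraph B);
  ucm_union : forall A B : fsgraph, P A -> P B -> P (dunion A B) }.

Definition edit_dist (R : realType) (V : finType) (G H : sgraph V) : R :=
  #|(edges G :\: edges H) :|: (edges H :\: edges G)|%:R / #|V|%:R.

Definition edit_dist_to (R : realType) (P : fsgraph -> Prop) (G : fsgraph) :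
    R :=
  inf [set edit_dist R G H | H in [set H : sgraph (vertex G) | P (FSGraph H)]].

(* Main.v *)
Require Import Defs.
From HB Require Import structures.
From mathcomp Require Import all_boot all_order all_algebra.
From mathcomp Require Import all_classical all_reals all_analysis.
From mathcomp Require Import fintype finset.

(* Write W(G) for the least number of edge changes that bring G into P, so that
   zeta(G) = W(G)/|G|.

   Union-closedness and monotonicity give a subadditivity principle (lemma
   transfer): if q disjoint copies of B embed in the vertex set of A so that
   every edge of A avoiding a small set Bad is the image of an edge of one
   copy, then W(A) <= q W(B) + d |Bad|.

   Subexponential growth provides the embedding.  Label the vertices at random
   with N labels and process the labels in order, each vertex carving out of
   what remains a ball of radius at most r whose boundary layer is small; such
   a radius exists because m^r f(r) < (m+1)^r.  Only vertices sharing their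
   label with a vertex within distance 2r misbehave, and these are few when N
   is large.  The cell of a vertex depends only on the labelled ball of radius
   3r(N+1) around it.  A second moment estimate yields, in every large graph of
   the sequence, a labelling whose frequencies of labelled ball types are close
   to their means, and these means converge by weak convergence.  Hence if
   B = G_k and A = G_n with n much larger than k, the cells of A and those of
   |A| %/ |B| copies of B match up to a small proportion, so that
   zeta(G_n) <= zeta(G_k) + epsilon, which forces convergence. *)

Set Implicit Arguments.
Unset Strict Implicit.
Unset Printing Implicit Defensive.

Local Open Scope nat_scope.

(** * Balls and local isomorphisms *)

Section Balls.
Variables (V : finType) (G : sgraph V).
Implicit Types (x y z : V) (r s : nat).

Lemma gball0 x y : (y \in gball G 0 x) = (y == x).
Proof.
rewrite inE; apply/existsP/eqP => [[[p /= sp] /andP[_ /eqP <-]]|->].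
  by move: sp; rewrite leqn0 size_eq0 => /eqP ->.
by exists (@Bseq 0 V [::] (leq0n 0)); rewrite /= eqxx.
Qed.

Lemma gballP r x y :
  reflect (exists p : seq V, [/\ size p <= r, path (adj G) x p & last x p = y])%N
          (y \in gball G r x).
Proof.
rewrite inE; apply: (iffP existsP) => [[[p /= sp] /andP[pp /eqP lp]]|[p [sp pp lp]]].
  by exists p.
by exists (Bseq sp); rewrite /= pp lp eqxx.
Qed.

Lemma gballS r x y :
  reflect (y \in gball G r x \/ exists2 z, z \in gball G r x & adj G z y)
          (y \in gball G r.+1 x).
Proof.
apply: (iffP idP) => [/gballP[p [sp pp lp]]|[/gballP[p [sp pp lp]]|
  [z /gballP[p [sp pp lp]] zy]]].
- case/lastP: p sp pp lp => [|p z] sp pp lp.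
    by left; apply/gballP; exists [::].
  right; move: sp pp lp; rewrite size_rcons rcons_path last_rcons ltnS.
  move=> sp /andP[pp zz] <-; exists (last x p) => //.
  by apply/gballP; exists p.
- by apply/gballP; exists p; split=> //; apply: leqW.
- by apply/gballP; exists (rcons p y); rewrite size_rcons rcons_path last_rcons pp lp.
Qed.

Lemma gball_mono r s x y : (r <= s)%N -> y \in gball G r x -> y \in gball G s x.
Proof.
move=> rs /gballP[p [sp pp lp]]; apply/gballP; exists p; split=> //.
exact: leq_trans rs.
Qed.

Lemma gball_trans r s x y z :
  y \in gball G r x -> z \in gball G s y -> z \in gball G (r + s) x.
Proof.
move=> /gballP[p [sp pp lp]] /gballP[q [sq pq lq]]; apply/gballP.
exists (p ++ q); rewrite size_cat cat_path last_cat lp lq pp pq.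
by split=> //; apply: leq_add.
Qed.

Lemma gball_adj x y : adj G x y -> y \in gball G 1 x.
Proof. by move=> xy; apply/gballS; right; exists x => //; rewrite gball0. Qed.

Lemma gball_symI r x y : y \in gball G r x -> x \in gball G r y.
Proof.
elim: r y => [|r IH] y; first by rewrite !gball0 eq_sym.
case/gballS => [/IH /gball_mono|[z /IH xz zy]]; first by apply.
by rewrite -add1n; apply: gball_trans xz; apply: gball_adj; rewrite adj_sym.
Qed.

End Balls.

Section LocalIso.
Variable L : Type.

(* [h] and [h'] are only required to be mutually inverse on the two balls;
   the symmetric formulation halves the arguments below. *)
Definition half_iso (V W : finType) (G : sgraph V) (H : sgraph W)
    (a : V -> L) (b : W -> L) (r : nat) (x : V) (y : W)
    (h : V -> W) (h' : W -> V) : Prop :=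
  h x = y /\ forall u, u \in gball G r x ->
    [/\ h u \in gball H r y, h' (h u) = u, b (h u) = a u &
        forall v, v \in gball G r x -> adj H (h u) (h v) = adj G u v].

Definition local_iso (V W : finType) (G : sgraph V) (H : sgraph W)
    (a : V -> L) (b : W -> L) r x y h h' : Prop :=
  half_iso G H a b r x y h h' /\ half_iso H G b a r y x h' h.

Lemma local_iso_sym (V W : finType) (G : sgraph V) (H : sgraph W)
    (a : V -> L) (b : W -> L) r x y h h' :
  local_iso G H a b r x y h h' -> local_iso H G b a r y x h' h.
Proof. by case. Qed.

Section Transport.
Variables (V W : finType) (G : sgraph V) (H : sgraph W) (a : V -> L) (b : W -> L).
Variables (r : nat) (x : V) (y : W) (h : V -> W) (h' : W -> V).
Hypothesis hh : local_iso G H a b r x y h h'.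

Lemma local_iso_root : h x = y.
Proof. by case: hh => -[]. Qed.

Lemma local_iso_in u : u \in gball G r x -> h u \in gball H r y.
Proof. by case: hh => -[_ h1] _ /h1[]. Qed.

Lemma local_isoK u : u \in gball G r x -> h' (h u) = u.
Proof. by case: hh => -[_ h1] _ /h1[]. Qed.

Lemma local_iso_lab u : u \in gball G r x -> b (h u) = a u.
Proof. by case: hh => -[_ h1] _ /h1[]. Qed.

Lemma local_iso_adj u v : u \in gball G r x -> v \in gball G r x ->
  adj H (h u) (h v) = adj G u v.
Proof. by case: hh => -[_ h1] _ /h1[_ _ _]; apply. Qed.

Lemma local_iso_inj : {in gball G r x &, injective h}.
Proof. by move=> u v /local_isoK {2}<- /local_isoK {2}<- ->. Qed.

(** A walk of length at most [s] from [u] stays in the ball of radius [t + s] about [x], where [h]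
    preserves adjacency. *)
Lemma local_iso_gball t s u v : (t + s <= r)%N ->
  u \in gball G t x -> v \in gball G s u -> h v \in gball H s (h u).
Proof.
elim: s v => [|s IH] v ts ut; first by rewrite !gball0 => /eqP ->.
have ts' : (t + s <= r)%N by apply: leq_trans ts; rewrite leq_add2l.
case/gballS => [vu|[z zu zv]]; apply/gballS; first by left; apply: IH.
right; exists (h z); first exact: IH.
have zr := gball_mono ts' (gball_trans ut zu).
rewrite local_iso_adj //; apply: gball_mono ts _.
by rewrite addnS -addn1; apply: gball_trans (gball_trans ut zu) (gball_adj zv).
Qed.

End Transport.

Lemma local_iso_gballE (V W : finType) (G : sgraph V) (H : sgraph W)
    (a : V -> L) (b : W -> L) r x y h h' t s u v :
  local_iso G H a b r x y h h' -> (t + s <= r)%N ->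
  u \in gball G t x -> v \in gball G r x ->
  (h v \in gball H s (h u)) = (v \in gball G s u).
Proof.
move=> hh ts ut vr; apply/idP/idP => [hv|]; last exact: (local_iso_gball hh ts ut).
have tr : (t <= r)%N by apply: leq_trans ts; rewrite leq_addr.
have ur := gball_mono tr ut.
rewrite -(local_isoK hh vr) -(local_isoK hh ur).
apply: (local_iso_gball (local_iso_sym hh) ts _ hv).
rewrite -(local_iso_root hh).
by apply: (local_iso_gball (t := 0) hh _ _ ut); rewrite ?add0n // gball0.
Qed.

End LocalIso.

(** * Carving *)

Lemma card_bigcup_le (I T : finType) (P : pred I) (A : I -> {set T}) :
  (#|\bigcup_(i | P i) A i| <= \sum_(i | P i) #|A i|)%N.
Proof.
apply: (big_ind2 (fun (B : {set T}) n => #|B| <= n)%N) => //.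
  by rewrite cards0.
move=> B n C k Bn Ck; apply: leq_trans (leq_card_setU B C) _.
exact: leq_add.
Qed.

Section Carving.
Variables (V : finType) (G : sgraph V) (N : nat) (lab : V -> 'I_N) (m r : nat).
Implicit Types (S : {set V}) (x y v : V).

(** The distance [2 * r] makes balls of radius [r] around equally labelled, conflict-free vertices
    disjoint. *)
Definition conf x : bool :=
  [exists y, [&& y \in gball G (2 * r) x, y != x & lab y == lab x]].

(** The first [k < r] at which one more step enlarges the part of the ball inside [S] by a factor at
    most [1 + 1/m]; if there is none, [find] returns the default [r]. *)
Definition carve_rad S v : nat :=
  find (fun k => m * #|S :&: gball G k.+1 v| <= m.+1 * #|S :&: gball G k v|)%N
       (iota 0 r).

Definition carve S v : {set V} :=
  if (v \in S) && ~~ conf v then S :&: gball G (carve_rad S v) v else set0%SET.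

(** What is left once the labels below [i] are processed. Vertices with the same label carve
    simultaneously from the same set. *)
Fixpoint remain (i : nat) : {set V} :=
  if i is j.+1 then
    [set x in remain j | [forall v, (lab v == j :> nat) ==> (x \notin carve (remain j) v)]]%SET
  else setT.

Definition cell v : {set V} := carve (remain (lab v)) v.

Definition layer v : {set V} :=
  let S := remain (lab v) in
  if (v \in S) && ~~ conf v
  then (S :&: gball G (carve_rad S v).+1 v) :\: gball G (carve_rad S v) v else set0%SET.

Definition bad : {set V} := [set x | conf x] :|: \bigcup_v layer v.

Lemma rad_le S v : (carve_rad S v <= r)%N.
Proof. by rewrite -[X in (_ <= X)%N](size_iota 0 r) find_size. Qed.

Lemma carve_sub S v : carve S v \subset S :&: gball G r v.
Proof.
rewrite /carve; case: ifP => _; last exact: sub0set.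
by apply/setIS/subsetP => y; apply: gball_mono; apply: rad_le.
Qed.

Lemma cell_gball v : cell v \subset gball G r v.
Proof. exact: subset_trans (carve_sub _ _) (subsetIr _ _). Qed.

Lemma remain_mono i j : (i <= j)%N -> remain j \subset remain i.
Proof.
move=> ij; rewrite -(subnK ij); elim: (j - i)%N => // k IH.
by apply: subset_trans IH; rewrite addSn /=; apply/subsetP => x; rewrite inE => /andP[].
Qed.

Lemma carve_conf S v : conf v -> carve S v = set0%SET.
Proof. by rewrite /carve => ->; rewrite andbF. Qed.

Lemma conf_near v w : lab v = lab w -> v != w ->
  w \in gball G (2 * r) v -> conf v.
Proof.
move=> lvw nvw wv; apply/existsP; exists w.
by rewrite wv eq_sym nvw lvw eqxx.
Qed.

Lemma cell_disjoint_lt v w x : x \in cell v -> x \in cell w -> ~~ (lab v < lab w)%N.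
Proof.
move=> xv /(subsetP (carve_sub _ _)); rewrite inE => /andP[xw _].
apply/negP => vw; have := subsetP (remain_mono vw) x xw.
rewrite /= inE => /andP[_ /forallP/(_ v)]; rewrite eqxx /=.
by rewrite -/(cell v) xv.
Qed.

(** Different labels are settled by the previous lemma. With equal labels, [v] and [w] are within
    [r] of [x], hence within [2 * r] of each other, so [v] conflicts and its cell is empty. *)
Lemma cell_inj v w x : x \in cell v -> x \in cell w -> v = w.
Proof.
move=> xv xw; apply/eqP; apply: contraLR xv => nvw.
case: (ltngtP (lab v) (lab w)) => [vw|vw|/val_inj vw].
- by apply: contraL vw => xv; apply: cell_disjoint_lt xv xw.
- by apply: contraL vw => xv; apply: cell_disjoint_lt xw xv.
apply/negP => xv; have: conf v.
  apply: conf_near vw nvw _.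
  rewrite mul2n -addnn; apply: gball_trans (subsetP (cell_gball v) _ xv) _.
  exact/gball_symI/(subsetP (cell_gball w)).
by move=> cv; move: xv; rewrite /cell carve_conf // inE.
Qed.

Hypothesis growth : forall v, (m ^ r * #|gball G r v| < m.+1 ^ r)%N.

(** If every [k < r] failed, the slice would grow by a factor above [1 + 1/m] at each of [r] steps,
    starting from size at least 1 because [v] lies in [S]. This contradicts [growth]. *)
Lemma rad_good S v : v \in S ->
  (m * #|S :&: gball G (carve_rad S v).+1 v| <= m.+1 * #|S :&: gball G (carve_rad S v) v|)%N.
Proof.
move=> vS; rewrite /carve_rad; set p := (X in find X).
case: (boolP (has p (iota 0 r))) => [hp|].
  have := nth_find 0 hp; rewrite nth_iota // -[X in (_ < X)%N](size_iota 0 r).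
  by rewrite -has_find.
move=> /hasPn np; exfalso.
have key k : (k <= r)%N -> (m.+1 ^ k <= m ^ k * #|S :&: gball G k v|)%N.
  elim: k => [_|k IH kr].
    rewrite !expn0 mul1n card_gt0; apply/set0Pn; exists v.
    by rewrite inE vS gball0 eqxx.
  have := np k; rewrite mem_iota /= => /(_ kr); rewrite /p -ltnNge => /ltnW lt.
  rewrite !expnS [(m * _)%N]mulnC -mulnA.
  apply: leq_trans (leq_mul (leqnn (m ^ k)) lt).
  by rewrite mulnCA leq_mul2l /= IH // ltnW.
have := leq_trans (key r (leqnn r))
  (leq_mul (leqnn _) (subset_leq_card (subsetIr S (gball G r v)))).
by rewrite leqNgt growth.
Qed.

Lemma layer_card v : (m * #|layer v| <= #|cell v|)%N.
Proof.
rewrite /layer /cell /carve; case: ifP => [/andP[vS _]|_]; last by rewrite !cards0 muln0.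
set S := remain _; set k := carve_rad S v.
have := rad_good vS; rewrite -/k mulSn addnC -leq_subLR -mulnBr; apply: leq_trans.
rewrite leq_mul2l; apply/orP; right; rewrite -cardsDS.
  apply/subset_leq_card/subsetP => x; rewrite !inE => /and3P[/negPf -> -> ->].
  by rewrite andbF.
by apply/setIS/subsetP => x; apply: gball_mono.
Qed.

Lemma cells_card : (\sum_v #|cell v| <= #|V|)%N.
Proof.
under eq_bigr => v _ do rewrite -sum1_card.
rewrite (exchange_big_dep predT) //= -sum1_card; apply: leq_sum => x _.
rewrite sum1_card; case: (pickP [pred v | x \in cell v]) => [v xv|xn].
  rewrite -(card1 v); apply/subset_leq_card/subsetP => w; rewrite !inE => xw.
  by apply/eqP; apply: cell_inj xw xv.
by rewrite eq_card0.
Qed.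

Lemma bad_card : (m * #|bad| <= #|V| + m * #|[set x | conf x]|)%N.
Proof.
apply: leq_trans (_ : m * (#|[set x | conf x]| + \sum_v #|layer v|) <= _)%N.
  rewrite leq_mul2l; apply/orP; right.
  apply: leq_trans (leq_card_setU _ _) _; rewrite leq_add2l.
  exact: card_bigcup_le.
rewrite mulnDr addnC leq_add2r big_distrr /=.
by apply: leq_trans cells_card; apply: leq_sum => v _; apply: layer_card.
Qed.

(** Either [x] survives until its own label is processed and then lies in its own cell, or an
    earlier cell took it. *)
Lemma cell_cover x : ~~ conf x -> exists v, x \in cell v.
Proof.
move=> nx; case: (boolP (x \in remain (lab x))) => [xr|].
  exists x; rewrite /cell /carve xr nx inE xr /=.
  exact: gball_root.
elim: (nat_of_ord (lab x)) => [|i IH] /=; first by rewrite inE.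
rewrite inE negb_and => /orP[/IH //|/forallPn[v]].
rewrite negb_imply negbK => /andP[/eqP vi xv].
by exists v; rewrite /cell vi.
Qed.

(** Let [v] carve no later than [w]. Then [y] is still present when [v] carves and is adjacent to a
    vertex of its cell; outside that cell it would lie in the layer of [v], hence in [bad]. *)
Lemma bad_edge x y : adj G x y -> x \notin bad -> y \notin bad ->
  exists v, (x \in cell v) && (y \in cell v).
Proof.
wlog: x y / exists v w, [/\ x \in cell v, y \in cell w & (lab v <= lab w)%N].
  move=> IH xy xb yb.
  have [v xv] : exists v, x \in cell v.
    by apply: cell_cover; apply: contra xb => cx; rewrite !inE cx.
  have [w yw] : exists w, y \in cell w.
    by apply: cell_cover; apply: contra yb => cy; rewrite !inE cy.
  case: (leqP (lab v) (lab w)) => vw; first by apply: IH => //; exists v, w.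
  have [||u /andP[]] // := IH y x _ _ yb xb; last by exists u; apply/andP.
  - by exists w, v; split=> //; apply: ltnW.
  - by rewrite adj_sym.
move=> [v [w [xv yw vw]]] xy _ yb; exists v; rewrite xv /=.
have yS : y \in remain (lab v).
  apply: (subsetP (remain_mono vw)).
  by have := subsetP (carve_sub _ _) _ yw; rewrite inE => /andP[].
move: yb; rewrite !inE negb_or => /andP[_ /bigcupP yl].
move: xv; rewrite /cell /carve; case: ifP; last by rewrite inE.
move=> vg; rewrite inE => /andP[xS xB]; rewrite inE yS /=.
apply/negPn/negP => yB; apply: yl; exists v => //.
rewrite /layer vg in_setD in_setI yB yS /= -addn1.
exact: gball_trans xB (gball_adj xy).
Qed.

End Carving.

(** * Locality of the carving *)

Section CarvingLocal.
Variables (N m r R : nat).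

Lemma local_iso_gball_root (L : Type) (V W : finType) (G : sgraph V)
    (H : sgraph W) (a : V -> L) (b : W -> L) x y h h' t u :
  local_iso G H a b R x y h h' -> (t <= R)%N ->
  u \in gball G t x -> h u \in gball H t y.
Proof.
move=> hh tR ut; rewrite -(local_iso_root hh).
by apply: (local_iso_gball hh (t := 0)) => //; rewrite gball0.
Qed.

Lemma conf_local (V W : finType) (G : sgraph V) (H : sgraph W)
    (a : V -> 'I_N) (b : W -> 'I_N) x y h h' t v :
  local_iso G H a b R x y h h' -> (t + 2 * r <= R)%N ->
  v \in gball G t x -> conf H b r (h v) = conf G a r v.
Proof.
have imp : forall (V W : finType) (G : sgraph V) (H : sgraph W)
    (a : V -> 'I_N) (b : W -> 'I_N) x y h h' t v,
    local_iso G H a b R x y h h' -> (t + 2 * r <= R)%N ->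
    v \in gball G t x -> conf G a r v -> conf H b r (h v).
  move=> {}V {}W {}G {}H {}a {}b {}x {}y {}h {}h' {}t {}v hh tR vt.
  case/existsP => w /and3P[wv nwv /eqP lwv].
  have vR : v \in gball G R x by apply: gball_mono vt; rewrite (leq_trans _ tR) ?leq_addr.
  have wR : w \in gball G R x by apply: gball_mono tR _; apply: gball_trans wv.
  apply/existsP; exists (h w); rewrite (local_iso_gball hh tR vt wv) /=.
  rewrite (local_iso_lab hh vR) (local_iso_lab hh wR) lwv eqxx andbT.
  by apply: contra nwv => /eqP/(local_iso_inj hh wR vR) ->.
move=> hh tR vt; apply/idP/idP; last exact: imp hh tR vt.
have tR' : (t <= R)%N by apply: leq_trans tR; rewrite leq_addr.
move=> /(imp _ _ _ _ _ _ _ _ _ _ t _ (local_iso_sym hh) tR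
  (local_iso_gball_root hh tR' vt)).
by rewrite (local_isoK hh (gball_mono tR' vt)).
Qed.

Section Carve.
Variables (V W : finType) (G : sgraph V) (H : sgraph W).
Variables (a : V -> 'I_N) (b : W -> 'I_N) (x : V) (y : W) (h : V -> W) (h' : W -> V).
Variables (t : nat) (v : V) (S : {set V}) (S' : {set W}).
Hypotheses (hh : local_iso G H a b R x y h h') (tR : (t + 2 * r <= R)%N).
Hypotheses (vt : v \in gball G t x).
Hypothesis SS' : forall u, u \in gball G r v -> (h u \in S') = (u \in S).

Let trR k : (k <= r)%N -> (t + k <= R)%N.
Proof.
move=> kr; apply: leq_trans tR; rewrite leq_add2l (leq_trans kr) //.
by rewrite leq_pmull.
Qed.

Lemma slice_local k : (k <= r)%N ->
  #|S' :&: gball H k (h v)| = #|S :&: gball G k v|.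
Proof.
move=> kr; have vR : v \in gball G R x.
  by apply: gball_mono vt; rewrite -(addn0 t) trR.
have sub u : u \in gball G k v -> u \in gball G R x.
  by move=> uv; apply: gball_mono (trR kr) (gball_trans vt uv).
rewrite -(card_in_imset (f := h) (D := S :&: gball G k v)).
  apply: eq_card => w; apply/idP/imsetP.
    rewrite in_setI => /andP[wS wB].
    have tR' : (t <= R)%N by rewrite -(addn0 t) trR.
    have hvt := local_iso_gball_root hh tR' vt.
    have wR : w \in gball H R y.
      by apply: gball_mono (trR kr) (gball_trans hvt wB).
    have wB' : h' w \in gball G k v.
      rewrite -(local_isoK hh vR).
      exact: (local_iso_gball (local_iso_sym hh) (trR kr) hvt wB).
    exists (h' w); last by rewrite (local_isoK (local_iso_sym hh)).
    rewrite in_setI wB' -SS' ?(local_isoK (local_iso_sym hh)) ?wS //.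
    exact: gball_mono wB'.
  case=> u; rewrite in_setI => /andP[uS uB] ->.
  rewrite in_setI SS' ?uS /=; last exact: gball_mono uB.
  exact: (local_iso_gball hh (trR kr) vt uB).
move=> u w; rewrite !in_setI => /andP[_ uB] /andP[_ wB].
by apply: (local_iso_inj hh); apply: sub.
Qed.

(** Equal slice sizes make [carve_rad] stop at the same radius on both sides. *)
Lemma carve_local u : u \in gball G R x ->
  (h u \in carve H b m r S' (h v)) = (u \in carve G a m r S v).
Proof.
move=> uR; have radE : carve_rad H m r S' (h v) = carve_rad G m r S v.
  rewrite /carve_rad; apply: eq_in_find => k; rewrite mem_iota /= => kr.
  by rewrite !slice_local // ltnW.
rewrite /carve radE (conf_local hh tR vt) SS' ?gball_root //.
case: ifP => _; last by rewrite !in_set0.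
rewrite !in_setI (local_iso_gballE hh (trR (rad_le _ _ _ _ _)) vt uR).
case: (boolP (u \in gball G (carve_rad G m r S v) v)) => uB; last by rewrite !andbF.
by rewrite SS' //; apply: gball_mono uB; apply: rad_le.
Qed.

End Carve.

(** Each label costs [3 * r]: the centre of a cell containing [u] is within [r] of [u], and deciding
    whether it conflicts looks a further [2 * r]. *)
Lemma remain_local i (V W : finType) (G : sgraph V) (H : sgraph W)
    (a : V -> 'I_N) (b : W -> 'I_N) x y h h' t u :
  local_iso G H a b R x y h h' -> (t + 3 * r * i <= R)%N ->
  u \in gball G t x ->
  (h u \in remain H b m r i) = (u \in remain G a m r i).
Proof.
elim: i V W G H a b x y h h' t u => [|i IH] V W G H a b x y h h' t u.
  by rewrite !inE.
move=> hh tR ut.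
have imp : forall (V W : finType) (G : sgraph V) (H : sgraph W)
    (a : V -> 'I_N) (b : W -> 'I_N) x y h h' u,
    local_iso G H a b R x y h h' -> u \in gball G t x ->
    forall v, a v = i :> nat -> u \in carve G a m r (remain G a m r i) v ->
    b (h v) = i :> nat /\ h u \in carve H b m r (remain H b m r i) (h v).
  move=> {}V {}W {}G {}H {}a {}b {}x {}y {}h {}h' {}u {}hh {}ut v vi uv.
  have vt : v \in gball G (t + r) x.
    apply: gball_trans ut _; apply: gball_symI.
    exact: subsetP (subset_trans (carve_sub _ _ _ _ _ _) (subsetIr _ _)) _ uv.
  have leR k : (k <= 3 * r * i.+1)%N -> (t + k <= R)%N.
    by move=> k3; apply: leq_trans tR; rewrite leq_add2l.
  have r3 : (t + r + 2 * r <= R)%N by rewrite -addnA leR // -mulSn mulnS leq_addr.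
  have vR : v \in gball G R x.
    by apply: gball_mono vt; apply: leq_trans r3; rewrite leq_addr.
  rewrite (local_iso_lab hh vR); split=> //.
  have uR : u \in gball G R x by apply: gball_mono ut; rewrite -(addn0 t) leR.
  rewrite (carve_local (t := t + r) (S := remain G a m r i) hh) // => w wv.
   apply: (IH _ _ _ _ _ _ _ _ _ _ (t + r + r)%N _ hh).
    rewrite -!addnA leR // addnA addnn -mul2n mulnS leq_add2r.
    by rewrite leq_mul2r orbT.
  exact: gball_trans wv.
have tR' : (t <= R)%N by apply: leq_trans tR; rewrite leq_addr.
have tRi : (t + 3 * r * i <= R)%N.
  by apply: leq_trans tR; rewrite leq_add2l leq_mul2l leqnSn orbT.
rewrite /= !inE (IH _ _ _ _ _ _ _ _ _ _ _ _ hh tRi ut); congr (_ && _).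
apply/forallP/forallP => nu v; apply/implyP => /eqP vi; apply/negP => uv.
  have [bi uv'] := imp _ _ _ _ _ _ _ _ _ _ _ hh ut _ vi uv.
  by have := nu (h v); rewrite bi eqxx uv'.
have [bi] := imp _ _ _ _ _ _ _ _ _ _ _ (local_iso_sym hh)
  (local_iso_gball_root hh tR' ut) _ vi uv.
rewrite (local_isoK hh (gball_mono tR' ut)) => uv'.
by have := nu (h' v); rewrite bi eqxx uv'.
Qed.

(** Fewer than [N] labels precede that of [x], each costing [3 * r]; the extra [3 * r] in the radius
    covers the last carving. *)
Lemma cell_local (V W : finType) (G : sgraph V) (H : sgraph W)
    (a : V -> 'I_N) (b : W -> 'I_N) x y h h' u :
  (3 * r * N.+1 <= R)%N -> local_iso G H a b R x y h h' ->
  u \in gball G R x ->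
  (h u \in cell H b m r y) = (u \in cell G a m r x).
Proof.
move=> RN hh uR; have xy := local_iso_root hh.
have xR : x \in gball G R x by rewrite gball_root.
rewrite /cell -xy (local_iso_lab hh xR).
apply: (carve_local (t := 0) hh) => //; rewrite ?gball0 //.
  apply: leq_trans RN; rewrite add0n mulnS (leq_trans _ (leq_addr _ _)) //.
  by rewrite leq_mul2r orbT.
move=> w wx; apply: (remain_local hh _ wx).
apply: leq_trans RN; rewrite mulnS leq_add //; first by rewrite leq_pmull.
by rewrite leq_mul2l ltnW ?orbT.
Qed.

End CarvingLocal.

(** * Types of labelled balls *)

Section Codes.
Variables (L : finType) (D R : nat).

(* Adjacency table, labels and root of a labelled ball, read along an
   enumeration of its vertices by part of ['I_D]. *)
Definition ball_code : finType :=
  ({ffun 'I_D * 'I_D -> option bool} * {ffun 'I_D -> option L} * 'I_D)%type.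

Definition reads (V : finType) (G : sgraph V) (a : V -> L) (x : V)
    (k : ball_code) (e : 'I_D -> option V) : Prop :=
  [/\ forall u, u \in gball G R x <-> exists i, e i = Some u,
      forall i j u, e i = Some u -> e j = Some u -> i = j,
      forall i j, k.1.1 (i, j) =
        if e i is Some u then omap (adj G u) (e j) else None,
      forall i, k.1.2 i = omap a (e i) &
      e k.2 = Some x].

Definition is_code (V : finType) (G : sgraph V) (a : V -> L) (x : V)
    (k : ball_code) : Prop := exists e, reads G a x k e.

Lemma is_code_ex (V : finType) (G : sgraph V) (a : V -> L) (x : V) :
  (#|gball G R x| <= D)%N -> exists k, is_code G a x k.
Proof.
move=> BD; set B := enum (gball G R x).
have sB : (size B <= D)%N by rewrite -cardE.
have idx u : u \in gball G R x -> (index u B < D)%N.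
  by move=> uB; apply: leq_trans sB; rewrite index_mem mem_enum.
pose e (i : 'I_D) := onth B i.
have eP i u : e i = Some u -> u \in B /\ i = index u B :> nat.
  move=> ei; have iB : (i < size B)%N.
    by rewrite ltnNge; apply/negP => iB; move: ei; rewrite /e onth_default.
  rewrite -(@onth_nth _ x _ _ _ ei); split; first exact: mem_nth.
  by rewrite index_uniq // enum_uniq.
have eI u (uB : u \in gball G R x) : e (Ordinal (idx u uB)) = Some u.
  rewrite /e /= onthE (nth_map u) ?index_mem ?mem_enum //.
  by rewrite nth_index // mem_enum.
exists ([ffun p => if e p.1 is Some u then omap (adj G u) (e p.2) else None],
        [ffun i => omap a (e i)], Ordinal (idx x (gball_root G R x))).
exists e; split=> /=.
- move=> u; split=> [uB|[i /eP[]]]; last by rewrite mem_enum.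
  by exists (Ordinal (idx u uB)).
- by move=> i j u /eP[_ iu] /eP[_ ju]; apply: val_inj; rewrite /= iu ju.
- by move=> i j; rewrite ffunE.
- by move=> i; rewrite ffunE.
- exact: eI.
Qed.

Lemma is_code_local (V W : finType) (G : sgraph V) (H : sgraph W)
    (a : V -> L) (b : W -> L) x y h h' k :
  local_iso G H a b R x y h h' -> is_code G a x k -> is_code H b y k.
Proof.
move=> hh [e [eB eI eA eL er]]; exists (fun i => omap h (e i)).
have eB' i u : e i = Some u -> u \in gball G R x by move=> eiu; apply/eB; exists i.
split.
- move=> w; split=> [wB|[i]].
    have h'w := local_iso_in (local_iso_sym hh) wB.
    have /eB[i ei] := h'w; exists i; rewrite ei /=.
    by rewrite (local_isoK (local_iso_sym hh)).
  by case ei: (e i) => [u|//] [<-]; apply: (local_iso_in hh); apply: eB' ei.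
- move=> i j w; case ei: (e i) => [u|//] [<-]; case ej: (e j) => [v|//] [huv].
  have uv : v = u by apply: (local_iso_inj hh) huv; [apply: eB' ej|apply: eB' ei].
  by apply: eI ei _; rewrite ej uv.
- move=> i j; rewrite eA; case ei: (e i) => [u|//]; case ej: (e j) => [v|//] /=.
  by rewrite (local_iso_adj hh) //; [apply: eB' ei|apply: eB' ej].
- move=> i; rewrite eL; case ei: (e i) => [u|//] /=.
  by rewrite (local_iso_lab hh) //; apply: eB' ei.
- by rewrite er /= (local_iso_root hh).
Qed.

(** Matches the vertices at the same position of two enumerations; [y] is the default where there is
    no match. *)
Definition transfer_map (V W : Type) (e : 'I_D -> option V) (e' : 'I_D -> option W)
    (y : W) (u : V) : W :=
  if [pick i | `[< e i = Some u >]] is Some i then odflt y (e' i) else y.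

Lemma transfer_mapE (V W : Type) (e : 'I_D -> option V) (e' : 'I_D -> option W) y u i w :
  (forall i j u, e i = Some u -> e j = Some u -> i = j) ->
  e i = Some u -> e' i = Some w -> transfer_map e e' y u = w.
Proof.
move=> eI eiu e'i; rewrite /transfer_map; case: pickP => [j /asboolP eju|].
  by rewrite (eI _ _ _ eju eiu) e'i.
by move=> /(_ i); rewrite asboolT.
Qed.

Lemma is_code_iso (V W : finType) (G : sgraph V) (H : sgraph W)
    (a : V -> L) (b : W -> L) x y k :
  is_code G a x k -> is_code H b y k ->
  exists h h', local_iso G H a b R x y h h'.
Proof.
have half : forall (V W : finType) (G : sgraph V) (H : sgraph W)
    (a : V -> L) (b : W -> L) x y (k : ball_code)
    (e : 'I_D -> option V) (e' : 'I_D -> option W),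
  reads G a x k e -> reads H b y k e' ->
  half_iso G H a b R x y (transfer_map e e' y) (transfer_map e' e x).
  move=> {}V {}W {}G {}H {}a {}b {}x {}y {}k e e'.
  move=> [eB eI eA eL er] [eB' eI' eA' eL' er'].
  have tr i u : e i = Some u -> exists2 w, e' i = Some w & transfer_map e e' y u = w.
    move=> ei; have := eL i; rewrite eL' ei; case ei': (e' i) => [w|//] _.
    by exists w => //; apply: transfer_mapE ei ei'.
  split; first exact: transfer_mapE er er'.
  move=> u /eB[i ei]; have [w ei' tu] := tr _ _ ei; rewrite tu; split.
  - by apply/eB'; exists i.
  - exact: transfer_mapE ei' ei.
  - by have := eL i; rewrite eL' ei ei' => -[].
  - move=> v /eB[j ej]; have [z ej' tv] := tr _ _ ej; rewrite tv.
    by have := eA i j; rewrite eA' ei ej ei' ej' /= => -[].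
move=> [e ce] [e' ce']; exists (transfer_map e e' y), (transfer_map e' e x).
by split; [apply: half ce ce'|apply: half ce' ce].
Qed.

(** A ball may have several codes, but [pick] depends only on the set of them, so isomorphic balls
    receive the same one. Balls with more than [D] vertices get [None]. *)
Definition ball_canon (V : finType) (G : sgraph V) (a : V -> L) (x : V) :
    option ball_code :=
  [pick k | `[< is_code G a x k >]].

Lemma ball_canon_local (V W : finType) (G : sgraph V) (H : sgraph W)
    (a : V -> L) (b : W -> L) x y h h' :
  local_iso G H a b R x y h h' -> ball_canon G a x = ball_canon H b y.
Proof.
move=> hh; rewrite /ball_canon; apply: eq_pick => k; apply: asbool_equiv_eq; split.
  exact: is_code_local hh.
exact: is_code_local (local_iso_sym hh).
Qed.

Lemma ball_canonP (V W : finType) (G : sgraph V) (H : sgraph W)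
    (a : V -> L) (b : W -> L) x y :
  (#|gball G R x| <= D)%N ->
  ball_canon G a x = ball_canon H b y <->
  exists h h', local_iso G H a b R x y h h'.
Proof.
move=> xD; split=> [|[h [h' hh]]]; last exact: ball_canon_local hh.
have [k xk] := is_code_ex a xD.
rewrite /ball_canon; case: pickP => [k1 /asboolP x1|]; last by move=> /(_ k); rewrite asboolT.
case: pickP => // k2 /asboolP y2 [k12]; rewrite -k12 in y2.
exact: is_code_iso x1 y2.
Qed.

End Codes.

(** * Matching cells *)

Definition pinjective (X Y : Type) (t : X -> option Y) : Prop :=
  forall x x' y, t x = Some y -> t x' = Some y -> x = x'.

(** The partial injection is inverted on its image; the other points of [Y] go injectively to points
    where [t] is undefined, of which there are enough because [#|Y| <= #|X|]. *)
Lemma pinjective_extend (X Y : finType) (t : X -> option Y) :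
  pinjective t -> #|Y| <= #|X| ->
  exists phi : Y -> X, injective phi /\ forall x y, t x = Some y -> phi y = x.
Proof.
move=> tI YX; pose U := [set x | t x]%SET.
pose Z := [set y | [exists x, t x == Some y]]%SET.
have UZ : #|U| = #|Z|.
  rewrite -(card_imset Z (@Some_inj _)).
  rewrite -(card_in_imset (f := t) (D := U)); last first.
    by move=> x x'; rewrite !inE; case tx: (t x) => [y|//] _ _ /esym; apply: tI.
  apply: eq_card => o; apply/imsetP/imsetP => [[x + ->]|[y + ->]]; rewrite inE.
    case tx: (t x) => [y|//] _; exists y => //; rewrite inE.
    by apply/existsP; exists x; rewrite tx.
  by case/existsP => x /eqP tx; exists x; rewrite ?inE tx.
have UZC : #|~: Z| <= #|~: U|.
  by rewrite -(leq_add2l #|Z|) -{2}UZ !cardsC.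
case: (pickP (@predT X)) => [x0 _|X0]; last first.
  have Y0 : forall y : Y, False.
    move=> y; move: YX; rewrite (eq_card0 X0) leqn0 => /eqP/card0_eq/(_ y).
    by rewrite inE.
  by exists (fun y => False_rect X (Y0 y)); split=> [y|x y]; case: (Y0 y).
pose phi y := if [pick x | t x == Some y] is Some x then x
              else nth x0 (enum (~: U)) (index y (enum (~: Z))).
have phiE x y : t x = Some y -> phi y = x.
  move=> tx; rewrite /phi; case: pickP => [x' /eqP tx'|/(_ x)]; first exact: tI tx' tx.
  by rewrite tx eqxx.
have phiZ y : y \in Z -> t (phi y) = Some y.
  by rewrite inE => /existsP[x /eqP tx]; rewrite (phiE x).
have phiN y : y \notin Z ->
    index y (enum (~: Z)) < size (enum (~: U)) /\
    phi y = nth x0 (enum (~: U)) (index y (enum (~: Z))).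
  move=> yZ; split.
    apply: leq_trans (_ : size (enum (~: Z)) <= _); rewrite -?cardE //.
    by rewrite cardE index_mem mem_enum inE yZ.
  rewrite /phi; case: pickP => // x tx; exfalso; move/negP: yZ; apply.
  by rewrite inE; apply/existsP; exists x.
have phiNU y : y \notin Z -> t (phi y) = None.
  case/phiN=> lt ->; have := mem_nth x0 lt; rewrite mem_enum !inE.
  by case: (t _).
exists phi; split=> // y y' pp.
case: (boolP (y \in Z)) (boolP (y' \in Z)) => yZ [] y'Z.
- by have := phiZ _ yZ; rewrite pp phiZ // => -[].
- by have := phiZ _ yZ; rewrite pp phiNU.
- by have := phiNU _ yZ; rewrite pp phiZ.
have [lt e] := phiN _ yZ; have [lt' e'] := phiN _ y'Z.
move: pp; rewrite e e' => /eqP; rewrite nth_uniq ?enum_uniq // => /eqP ii.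
have yin : y \in enum (~: Z) by rewrite mem_enum inE.
have y'in : y' \in enum (~: Z) by rewrite mem_enum inE.
by rewrite -(nth_index y yin) ii nth_index.
Qed.

(** Within each colour the [i]-th point of [X] is matched with the [i]-th point of [Y], so only the
    surplus of [X] in that colour, a truncated difference, stays unmatched. *)
Lemma colour_matching (X Y K : finType) (k : X -> K) (k' : Y -> K) :
  exists psi : X -> option Y,
  [/\ pinjective psi, forall x y, psi x = Some y -> k x = k' y &
      #|[set x | ~~ psi x]%SET| <=
        \sum_c (#|[set x | k x == c]%SET| - #|[set y | k' y == c]%SET|)].
Proof.
pose EX c := enum [set x | k x == c]%SET; pose EY c := enum [set y | k' y == c]%SET.
pose psi x := onth (EY (k x)) (index x (EX (k x))).
have kx x : x \in EX (k x) by rewrite mem_enum inE.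
have psiP x y : psi x = Some y ->
    [/\ index x (EX (k x)) < size (EY (k x)), y \in EY (k x) &
        index y (EY (k x)) = index x (EX (k x))].
  move=> px; have lt : index x (EX (k x)) < size (EY (k x)).
    by rewrite -onthTE; rewrite /psi in px; rewrite px.
  by rewrite -(@onth_nth _ y _ _ _ px) mem_nth // index_uniq ?enum_uniq.
have psik x y : psi x = Some y -> k x = k' y.
  by move=> /psiP[_ + _]; rewrite mem_enum inE => /eqP.
exists psi; split=> //.
  move=> x x' y px px'; have kxx : k x = k x' by rewrite (psik _ _ px) (psik _ _ px').
  have [_ _ ix] := psiP _ _ px; have [_ _] := psiP _ _ px'.
  rewrite -kxx ix => /(congr1 (nth x (EX (k x)))).
  by rewrite !nth_index // kxx.
rewrite -sum1dep_card (partition_big k predT) //=; apply: leq_sum => c _.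
rewrite sum1dep_card; set n := #|[set y | k' y == c]%SET|.
(* An unmatched point has index at least [n] in its class, hence belongs to [drop n (EX c)], whose
   size is the surplus. *)
have -> : #|[set x | k x == c]%SET| - n = size (drop n (EX c)) by rewrite size_drop cardE.
apply: leq_trans (card_size _); apply/subset_leq_card/subsetP => x.
rewrite inE => /andP[px /eqP xc].
have nx : n <= index x (EX c).
  by rewrite /n cardE leqNgt -onthTE -[enum _]/(EY c) -xc.
have xE : x \in EX c by rewrite -xc.
rewrite -(nth_index x xE) -(subnKC nx) -nth_drop mem_nth //.
have ix : index x (EX c) < size (EX c) by rewrite index_mem.
by rewrite size_drop; apply: (ltn_sub2r _ ix); apply: leq_ltn_trans nx ix.
Qed.

Section CellMatching.
Variables (N D R m r : nat) (V W : finType) (A : sgraph V) (B : sgraph W).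
Variables (a : V -> 'I_N) (b : W -> 'I_N) (q : nat).

(** Centres in [A] are matched with centres in the [q] copies of [B] having the same labelled ball
    type. Local isomorphisms carry matched cells onto each other; as cells are disjoint, these
    pieces glue to a partial injection, which is then extended. [Bad] collects the bad vertices of
    the carving and the cells of unmatched centres. *)
Lemma cell_matching :
  3 * r * N.+1 <= R ->
  (forall x, #|gball A R x| <= D) -> (forall y, #|gball B R y| <= D) ->
  (forall x, m ^ r * #|gball A r x| < m.+1 ^ r) ->
  q * #|W| <= #|V| ->
  exists (phi : 'I_q * W -> V) (Bad : {set V}),
  [/\ injective phi,
      forall x y, adj A x y -> x \notin Bad -> y \notin Bad ->
        exists j u v, [/\ x = phi (j, u), y = phi (j, v) & adj B u v] &
      m * #|Bad| <= #|V| + m * #|[set x | conf A a r x]%SET| + m * (D *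
        \sum_c (#|[set x | ball_canon D R A a x == c]%SET| -
                q * #|[set y | ball_canon D R B b y == c]%SET|))].
Proof.
move=> RN AD BD growth qVW.
have rR : r <= R.
  by apply: leq_trans RN; apply: leq_trans (leq_pmulr _ _); rewrite ?leq_pmull.
pose k x := ball_canon D R A a x.
pose k' (p : 'I_q * W) := ball_canon D R B b p.2.
have [psi [psi_inj psik psi_card]] := colour_matching k k'.
(* One isomorphism is chosen for each pair of centres; constant maps fill in when the ball types
   differ. *)
have /choice[hh hhP] : forall p : V * W, exists h : (V -> W) * (W -> V),
    k p.1 = ball_canon D R B b p.2 -> local_iso A B a b R p.1 p.2 h.1 h.2.
  case=> v w /=; have [/ball_canonP [//|h [h' hP]]|ne] := pselect (k v = ball_canon D R B b w).
    by exists (h, h').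
  by exists (fun=> w, fun=> v).
have psiL v j w : psi v = Some (j, w) ->
    local_iso A B a b R v w (hh (v, w)).1 (hh (v, w)).2.
  by move=> /psik kv; apply: (hhP (v, w)).
pose cA := cell A a m r; pose cB := cell B b m r.
have inR v x : x \in cA v -> x \in gball A R v.
  by move=> /(subsetP (cell_gball _ _ _ _ _)); apply: gball_mono.
pose theta x : option ('I_q * W) :=
  if [pick v | x \in cA v] is Some v then
    if psi v is Some (j, w) then Some (j, (hh (v, w)).1 x) else None
  else None.
have thetaE v j w x : x \in cA v -> psi v = Some (j, w) ->
    theta x = Some (j, (hh (v, w)).1 x).
  move=> xv pv; rewrite /theta; case: pickP => [v' xv'|/(_ v)]; last by rewrite xv.
  by rewrite (cell_inj xv' xv) pv.
have thetaP x p : theta x = Some p -> exists v w,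
    [/\ x \in cA v, psi v = Some (p.1, w) & p.2 = (hh (v, w)).1 x].
  rewrite /theta; case: pickP => // v xv; case pv: (psi v) => [[j w]|//] [<-].
  by exists v, w.
(* A common image lies in the cells of [w] and [w'], so [w = w']. The copy index is equal too, so
   the centres coincide, and the isomorphism is injective on their ball. *)
have theta_inj : pinjective theta.
  move=> x x' p /thetaP[v [w [xv pv px]]] /thetaP[v' [w' [xv' pv' px']]].
  have pw : p.2 \in cB w.
    by rewrite px (cell_local _ RN (psiL _ _ _ pv)) // inR.
  have pw' : p.2 \in cB w'.
    by rewrite px' (cell_local _ RN (psiL _ _ _ pv')) // inR.
  move: pv' px'; rewrite -(cell_inj pw pw') => pv' px'.
  have vv : v = v' by apply: psi_inj pv pv'.
  move: px' xv'; rewrite -vv px => hxx xv'.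
  by apply: (local_iso_inj (psiL _ _ _ pv)) hxx; apply: inR.
have [|phi [phi_inj phiE]] := pinjective_extend theta_inj.
  by rewrite card_prod card_ord.
exists phi, (bad A a m r :|: \bigcup_(v | ~~ psi v) cA v)%SET; split=> //.
  move=> x y xy; rewrite ![_ \in bad _ _ _ _ :|: _]in_setU !negb_or => /andP[xb xu] /andP[yb _].
  have [v /andP[xv yv]] := bad_edge xy xb yb.
  case pv: (psi v) => [[j w]|]; last first.
    by case/negP: xu; apply/bigcupP; exists v; rewrite ?pv.
  exists j, ((hh (v, w)).1 x), ((hh (v, w)).1 y).
  rewrite (phiE _ _ (thetaE _ _ _ _ xv pv)) (phiE _ _ (thetaE _ _ _ _ yv pv)).
  split=> //.
  by rewrite (local_iso_adj (psiL _ _ _ pv)) ?inR.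
apply: leq_trans (leq_mul (leqnn m) (leq_card_setU _ _)) _.
rewrite mulnDr leq_add ?bad_card // leq_mul2l; apply/orP; right.
apply: leq_trans (card_bigcup_le _ _) _.
apply: leq_trans (_ : \sum_(v | ~~ psi v) D <= _).
  apply: leq_sum => v _; apply: leq_trans (AD v).
  by apply/subset_leq_card/subsetP => x; apply: inR.
rewrite sum_nat_const mulnC leq_mul2l; apply/orP; right.
move: psi_card; rewrite cardsE => /leq_trans; apply.
(* Each vertex of [B] of type [c] contributes [q] copies of that type. *)
apply: leq_sum => c _; apply: leq_sub2l.
rewrite -[q in q * _]card_ord -[X in X * _]cardsT -cardsX.
by apply/subset_leq_card/subsetP => -[j w]; rewrite in_setX !inE.
Qed.

End CellMatching.

(** * Union-closed monotone properties *)

Section Edges.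
Variables (V : finType) (G : sgraph V).

Lemma edgesP (E : {set V}) :
  reflect (exists x y, adj G x y /\ E = [set x; y]%SET) (E \in edges G).
Proof.
apply: (iffP imsetP) => [[[x y] + ->]|[x [y [xy ->]]]].
  by rewrite inE /= => xy; exists x, y.
by exists (x, y); rewrite ?inE.
Qed.

Lemma mem_edges x y : ([set x; y]%SET \in edges G) = adj G x y.
Proof.
apply/edgesP/idP => [[u [v [uv xyuv]]]|xy]; last by exists x, y.
have xin : x \in [set u; v]%SET by rewrite -xyuv !inE eqxx.
have yin : y \in [set u; v]%SET by rewrite -xyuv !inE eqxx orbT.
have uin : u \in [set x; y]%SET by rewrite xyuv !inE eqxx.
have vin : v \in [set x; y]%SET by rewrite xyuv !inE eqxx orbT.
have nuv : u != v by apply: contraTneq uv => ->; rewrite adj_irr.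
move: xin yin uin vin; rewrite !in_set2.
case/orP=> /eqP ->; case/orP => /eqP -> //; rewrite ?orbb.
- by move=> _ /eqP vu; rewrite vu eqxx in nuv.
- by rewrite adj_sym.
- by move=> /eqP vu; rewrite vu eqxx in nuv.
Qed.

Lemma edges_at (B : {set V}) d : (forall x, degree G x <= d) ->
  #|[set E in edges G | [exists x in B, x \in E]]%SET| <= d * #|B|.
Proof.
move=> Gd; pose N x := [set [set x; y]%SET | y in [set y | adj G x y]%SET]%SET.
apply: leq_trans (_ : #|\bigcup_(x in B) N x|%SET <= _).
  apply/subset_leq_card/subsetP => E; rewrite inE.
  case/andP=> /edgesP[u [v [uv ->]]] /existsP[x /andP[xB]].
  rewrite in_set2 => /orP[/eqP xu|/eqP xv]; apply/bigcupP; exists x => //.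
    by apply/imsetP; exists v; rewrite ?inE xu.
  by apply/imsetP; exists u; rewrite ?inE xv 1?adj_sym // finset.setUC.
apply: leq_trans (card_bigcup_le _ _) _; rewrite mulnC -sum_nat_const.
apply: leq_sum => x _; exact: leq_trans (leq_imset_card _ _) (Gd x).
Qed.

End Edges.

Lemma inj_surj_bij (T S : finType) (f : T -> S) :
  injective f -> (forall y, exists x, f x = y) -> bijective f.
Proof.
move=> fI fS; apply: inj_card_bij fI _.
rewrite -[X in X <= _]cardsT -(cardsT T); apply: leq_trans (leq_imset_card f _).
by apply/subset_leq_card/subsetP => y _; have [x <-] := fS y; apply: imset_f.
Qed.

Section Copies.
Variables (V : finType) (G : sgraph V) (q : nat).

Definition copies_adj : rel ('I_q * V) := fun u v => (u.1 == v.1) && adj G u.2 v.2.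

Fact copies_sym : symmetric copies_adj.
Proof. by move=> u v; rewrite /copies_adj eq_sym adj_sym. Qed.

Fact copies_irr : irreflexive copies_adj.
Proof. by move=> u; rewrite /copies_adj adj_irr andbF. Qed.

Definition copies : sgraph ('I_q * V)%type := SGraph copies_sym copies_irr.

End Copies.

Section Spread.
Variables (T V : finType) (K : sgraph T) (phi : T -> V).

(** The push-forward of [K] along [phi]; vertices outside the image are isolated. *)
Definition spread_adj : rel V := fun x y =>
  [exists p, [exists p', [&& x == phi p, y == phi p' & adj K p p']]].

Lemma spread_adjP x y :
  reflect (exists p p', [/\ x = phi p, y = phi p' & adj K p p']) (spread_adj x y).
Proof.
apply: (iffP existsP) => [[p /existsP[p' /and3P[/eqP -> /eqP -> pp']]]|].
  by exists p, p'.
by case=> p [p' [-> -> pp']]; exists p; apply/existsP; exists p'; rewrite !eqxx.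
Qed.

Hypothesis phi_inj : injective phi.

Fact spread_sym : symmetric spread_adj.
Proof.
move=> x y; apply/spread_adjP/spread_adjP => -[p [p' [xp yp pp]]];
  by exists p', p; rewrite adj_sym.
Qed.

Fact spread_irr : irreflexive spread_adj.
Proof.
move=> x; apply/negbTE/negP => /spread_adjP[p [p' [-> /phi_inj <-]]].
by rewrite adj_irr.
Qed.

Definition spread : sgraph V := SGraph spread_sym spread_irr.

End Spread.

Section Inter.
Variables (V : finType) (G H : sgraph V).

Definition inter_adj : rel V := fun x y => adj G x y && adj H x y.

Fact inter_sym : symmetric inter_adj.
Proof. by move=> x y; rewrite /inter_adj [adj G x y]adj_sym [adj H x y]adj_sym. Qed.

Fact inter_irr : irreflexive inter_adj.
Proof. by move=> x; rewrite /inter_adj adj_irr. Qed.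

Definition inter : sgraph V := SGraph inter_sym inter_irr.

End Inter.

Section Property.
Variables (d : nat) (P : fsgraph -> Prop).
Hypothesis hP : union_closed_monotone d P.

Lemma edgeless_P (V : finType) (G : sgraph V) :
  (forall x y, adj G x y = false) -> P (FSGraph G).
Proof.
move=> G0; apply: (ucm_edgeless hP); apply/eqP; rewrite cards_eq0 -finset.subset0.
by apply/subsetP => E /edgesP[x [y [/=]]]; rewrite G0.
Qed.

(** By induction: [q + 1] copies are the disjoint union of one copy, placed at [ord0], and [q]
    copies shifted by [lift ord0]. *)
Lemma copies_P (V : finType) (G : sgraph V) q :
  P (FSGraph G) -> P (FSGraph (copies G q)).
Proof.
move=> PG; elim: q => [|q IH]; first by apply: edgeless_P => -[[]].
apply: (ucm_iso hP) (ucm_union hP PG IH).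
pose g (s : V + 'I_q * V) : 'I_q.+1 * V :=
  match s with inl x => (ord0, x) | inr p => (lift ord0 p.1, p.2) end.
exists g.
  apply: inj_surj_bij => [[x|[i x]] [y|[j y]]|[i x]] /=.
  - by case=> ->.
  - by move=> /pair_equal_spec[/eqP]; rewrite eq_liftF.
  - by move=> /pair_equal_spec[/eqP]; rewrite eq_sym eq_liftF.
  - by move=> /pair_equal_spec[/lift_inj -> ->].
  - case: (unliftP ord0 i) => [j|] ->; first by exists (inr (j, x)).
    by exists (inl x).
move=> [x|[i x]] [y|[j y]] //=; rewrite /copies_adj /= (inj_eq lift_inj).
Qed.

(** The push-forward is the disjoint union of [K] and an edgeless graph on the complement of the
    image. *)
Lemma spread_P (T V : finType) (K : sgraph T) (phi : T -> V)
    (phi_inj : injective phi) :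
  P (FSGraph K) -> P (FSGraph (spread K phi_inj)).
Proof.
move=> PK; pose S := {x | x \notin codom phi}.
have sym0 : symmetric (fun _ _ : S => false) by [].
have irr0 : irreflexive (fun _ _ : S => false) by [].
have P0 : P (FSGraph (SGraph sym0 irr0)) by apply: edgeless_P.
apply: (ucm_iso hP) (ucm_union hP PK P0).
exists (fun s : T + S => match s with inl p => phi p | inr z => val z end).
  apply: inj_surj_bij => [[p|z] [p'|z']|x] /=.
  - by move=> /phi_inj ->.
  - by move=> pz; have := valP z'; rewrite /= -pz codom_f.
  - by move=> pz; have := valP z; rewrite /= pz codom_f.
  - by move=> /val_inj ->.
  - case: (boolP (x \in codom phi)) => [/codomP[p ->]|xn]; first by exists (inl p).
    by exists (inr (exist _ x xn)).
move=> [p|z] [p'|z'] /=.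
- apply/spread_adjP/idP => [[u [v [/phi_inj -> /phi_inj ->]]] //|pp'].
  by exists p, p'.
- by apply/negbTE/negP => /spread_adjP[u [v [_ zv]]]; have := valP z'; rewrite /= zv codom_f.
- by apply/negbTE/negP => /spread_adjP[u [v [zv _]]]; have := valP z; rewrite /= zv codom_f.
- by apply/negbTE/negP => /spread_adjP[u [v [zv _]]]; have := valP z; rewrite /= zv codom_f.
Qed.

(** [HA] consists of the edges of [A] in the image of [q] copies of [H], so it is a spanning
    subgraph of a member of [P]. An edge of [A] outside [HA] meets [Bad], or is the image of an edge
    of [B] missing from [H]; the degree bound counts the former. *)
Lemma transfer (V W : finType) (A : sgraph V) (B H : sgraph W) (q : nat)
    (phi : 'I_q * W -> V) (Bad : {set V}) :
  P (FSGraph H) -> injective phi -> (forall x, degree A x <= d) ->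
  (forall x y, adj A x y -> x \notin Bad -> y \notin Bad ->
     exists j u v, [/\ x = phi (j, u), y = phi (j, v) & adj B u v]) ->
  exists HA : sgraph V, P (FSGraph HA) /\
    #|(edges A :\: edges HA) :|: (edges HA :\: edges A)| <=
    q * #|(edges B :\: edges H) :|: (edges H :\: edges B)| + d * #|Bad|.
Proof.
move=> PH phi_inj Ad AB; pose K := spread (copies H q) phi_inj.
exists (inter A K); split.
  have PK : P (FSGraph K) by apply: spread_P; apply: copies_P.
  apply: (ucm_spanning hP PK); apply/subsetP => _ /edgesP[x [y [/andP[_ xy] ->]]].
  by rewrite mem_edges.
pose X (j : 'I_q) :=
  [set [set phi (j, z) | z in (E : {set W})]%SET | E in edges B :\: edges H]%SET.
apply: leq_trans (_ : #|(\bigcup_j X j) :|: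
    [set E in edges A | [exists x in Bad, x \in E]]| <= _)%SET.
  apply/subset_leq_card/subsetP => E; rewrite in_setU !in_setD => /orP[|]; last first.
    case/andP=> nE /edgesP[x [y [/= /andP[xy _] EE]]].
    by rewrite EE mem_edges xy in nE.
  case/andP=> nE /edgesP[x [y [xy EE]]]; rewrite EE mem_edges in nE *.
  rewrite in_setU; case: (boolP (x \in Bad)) => [xb|xb].
    rewrite [X in _ || X]inE mem_edges xy; apply/orP; right.
    by apply/existsP; exists x; rewrite xb !inE eqxx.
  case: (boolP (y \in Bad)) => [yb|yb].
    rewrite [X in _ || X]inE mem_edges xy; apply/orP; right.
    by apply/existsP; exists y; rewrite yb !inE eqxx orbT.
  apply/orP; left; have [j [u [v [xu yv uv]]]] := AB _ _ xy xb yb.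
  apply/bigcupP; exists j => //; apply/imsetP; exists [set u; v]%SET.
    rewrite in_setD !mem_edges uv andbT; apply: contra nE => uvH.
    rewrite /= /inter_adj xy /=; apply/spread_adjP; exists (j, u), (j, v).
    by rewrite /= /copies_adj eqxx.
  by rewrite imsetU !imset_set1 xu yv.
apply: leq_trans (leq_card_setU _ _) _; apply: leq_add; last exact: edges_at.
apply: leq_trans (card_bigcup_le _ _) _; rewrite -[X in X * _](card_ord q).
rewrite -sum_nat_const; apply: leq_sum => j _.
apply: leq_trans (leq_imset_card _ _) _.
by apply/subset_leq_card/subsetP => E; rewrite in_setU => ->.
Qed.

End Property.

Import Order.TTheory GRing.Theory Num.Theory.
Local Open Scope ring_scope.

(** * Random labellings *)

Section Independence.
Variables (F : realFieldType) (V L : finType).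
Notation Omega := {ffun V -> L}.

Definition depends_on (T : Type) (S : {set V}) (g : Omega -> T) :=
  forall w w' : Omega, (forall u, u \in S -> w u = w' u) -> g w = g w'.

(** Swapping two labellings outside [S] is an involution of pairs; it turns [f w * g w'] into a
    product evaluated at a single labelling. *)
Lemma sum_indep (S T : {set V}) (f g : Omega -> F) :
  depends_on S f -> depends_on T g -> [disjoint S & T] ->
  (\sum_w f w) * (\sum_w g w) = #|{: Omega}|%:R * \sum_w f w * g w.
Proof.
move=> fS gT dST.
pose mix (p : Omega * Omega) : Omega * Omega :=
  ([ffun u => if u \in S then p.1 u else p.2 u],
   [ffun u => if u \in S then p.2 u else p.1 u]).
have mixK : involutive mix.
  by case=> w w'; congr pair; apply/ffunP => u; rewrite /= !ffunE; case: (u \in S).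
rewrite mulr_suml; under eq_bigr => w _ do rewrite mulr_sumr.
rewrite pair_big /= (eq_bigr (fun p => f (mix p).1 * g (mix p).1)); last first.
  move=> [w w'] _ /=; congr (_ * _); first by apply: fS => u uS; rewrite ffunE uS.
  by apply: gT => u uT; rewrite ffunE (disjointFl dST uT).
transitivity (\sum_(p : Omega * Omega) f p.1 * g p.1).
  by rewrite [RHS](reindex_inj (inv_inj mixK)).
rewrite -(pair_big predT predT (fun w _ => f w * g w)) /=.
under eq_bigr => w _ do rewrite sumr_const.
by rewrite mulr_natl -sumrMnl.
Qed.

Variables (e : Omega -> V -> bool) (B : V -> {set V}) (M : nat).
Hypothesis eB : forall x, depends_on (B x) (e^~ x).
Hypothesis BM : forall x, (#|[set z | ~~ [disjoint B x & B z]]| <= M)%N.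
Hypothesis Omega0 : (0 < #|{: Omega}|)%N.

Definition hits (w : Omega) : F := #|[set x | e w x]|%:R.
Definition prob (x : V) : F := #|[set w | e w x]|%:R / #|{: Omega}|%:R.

Lemma hitsE w : hits w = \sum_x (e w x)%:R.
Proof.
rewrite /hits -sum1dep_card natr_sum [LHS]big_mkcond /=.
by apply: eq_bigr => x _; case: (e w x).
Qed.

Lemma sum_event x : \sum_w (e w x)%:R = #|{: Omega}|%:R * prob x :> F.
Proof.
rewrite /prob mulrC divfK ?pnatr_eq0 -?lt0n //.
rewrite -sum1dep_card natr_sum [RHS]big_mkcond /=.
by apply: eq_bigr => w _; case: (e w x).
Qed.

Lemma prob_ge0 x : 0 <= prob x.
Proof. by rewrite divr_ge0. Qed.

Lemma prob_le1 x : prob x <= 1.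
Proof.
rewrite ler_pdivrMr ?ltr0n // mul1r ler_nat.
exact: max_card.
Qed.

(** Expand the square into pairs [x], [z]. Centred indicators with disjoint supports [B x] and [B z]
    are independent, so these pairs sum to zero; each of the at most [#|V| * M] others contributes
    at most the number of labellings. *)
Lemma second_moment :
  \sum_w (hits w - \sum_x prob x) ^+ 2 <= (#|{: Omega}| * (#|V| * M))%:R.
Proof.
pose y w x : F := (e w x)%:R - prob x.
have -> : \sum_w (hits w - \sum_x prob x) ^+ 2 =
          \sum_x \sum_z \sum_w y w x * y w z.
  under [RHS]eq_bigr => x _ do rewrite exchange_big /=.
  rewrite [RHS]exchange_big /=; apply: eq_bigr => w _.
  by rewrite hitsE -sumrB expr2 big_distrlr.
have y0 x : \sum_w y w x = 0.
  by apply/eqP; rewrite /y sumrB sum_event sumr_const mulr_natl subr_eq0.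
have yB x : depends_on (B x) (y^~ x).
  by move=> w w' ww'; rewrite /y (eB ww').
have y1 w x : `|y w x| <= 1.
  rewrite /y ler_norml; case: (e w x) => /=.
    rewrite [X in _ && X]lerBlDr lerDl prob_ge0 andbT.
    by rewrite (@le_trans _ _ 0) ?lerN10 // subr_ge0 prob_le1.
  by rewrite sub0r lerN2 prob_le1 /= (@le_trans _ _ 0) ?ler01 // oppr_le0 prob_ge0.
have far x z : [disjoint B x & B z] -> \sum_w y w x * y w z = 0.
  move=> dxz; have := sum_indep (yB x) (yB z) dxz; rewrite !y0 mul0r.
  by move=> /esym/eqP; rewrite mulf_eq0 pnatr_eq0 -leqn0 leqNgt Omega0 => /eqP.
have near x z : \sum_w y w x * y w z <= #|{: Omega}|%:R.
  rewrite -sum1_card natr_sum; apply: ler_sum => w _.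
  apply: le_trans (ler_norm _) _; rewrite normrM -[X in _ <= X]mulr1.
  exact: ler_pM.
rewrite mulnCA -[X in (X * _)%N]sum1_card big_distrl natr_sum /=.
apply: ler_sum => x _; rewrite mul1n.
rewrite (bigID [pred z | z \in [set z | ~~ [disjoint B x & B z]]]) /=.
rewrite [X in _ + X]big1 ?addr0 => [|z]; last by rewrite inE negbK; apply: far.
apply: le_trans (ler_sum _ (fun z _ => near x z)) _.
rewrite sumr_const -mulrnA ler_nat leq_mul2l.
by apply/orP; right; apply: BM.
Qed.

End Independence.

(** * Events determined by a labelled ball *)

Definition event (L : Type) :=
  forall (V : finType) (G : sgraph V) (a : V -> L) (x : V), bool.

Definition local_event (L : Type) (R : nat) (e : event L) : Prop :=
  forall (V W : finType) (G : sgraph V) (H : sgraph W) (a : V -> L) (b : W -> L)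
    x y h h', local_iso G H a b R x y h h' -> e V G a x = e W H b y.

Section LocalEvents.
Variables (F : realFieldType) (L : finType) (R : nat).
Implicit Type e : event L.
Hypothesis L0 : (0 < #|L|)%N.

Definition eprob e (V : finType) (G : sgraph V) (x : V) : F :=
  prob F (fun (w : {ffun V -> L}) x => e V G w x) x.

Definition ehits e (V : finType) (G : sgraph V) (w : {ffun V -> L}) : F :=
  hits F (fun (w : {ffun V -> L}) x => e V G w x) w.

Lemma labellings_gt0 (V : finType) : (0 < #|{: {ffun V -> L}}|)%N.
Proof. by rewrite card_ffun expn_gt0 L0. Qed.

Lemma local_event_depends e (V : finType) (G : sgraph V) x :
  local_event R e ->
  depends_on (gball G R x) (fun w : {ffun V -> L} => e V G w x).
Proof.
move=> le w w' ww'; apply: (le _ _ _ _ _ _ _ _ id id).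
by split; split=> // u ux; split=> //; rewrite ww'.
Qed.

(* Exchanging the labels of the two balls along the isomorphism is an
   involution of pairs of labellings that exchanges the two events. *)
Lemma eprob_local e (V W : finType) (G : sgraph V) (H : sgraph W) x y h h' :
  local_event R e ->
  local_iso G H (fun=> tt) (fun=> tt) R x y h h' ->
  eprob e G x = eprob e H y.
Proof.
move=> le hh.
pose sw (p : {ffun V -> L} * {ffun W -> L}) : {ffun V -> L} * {ffun W -> L} :=
  ([ffun u => if u \in gball G R x then p.2 (h u) else p.1 u],
   [ffun u => if u \in gball H R y then p.1 (h' u) else p.2 u]).
have swK : involutive sw.
  case=> w w'; congr pair; apply/ffunP => u; rewrite /= !ffunE.
    case uB: (u \in gball G R x) => //.
    by rewrite (local_iso_in hh uB) (local_isoK hh uB).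
  case uB: (u \in gball H R y) => //.
  by rewrite (local_iso_in (local_iso_sym hh) uB) (local_isoK (local_iso_sym hh) uB).
pose A := [set w : {ffun V -> L} | e V G w x].
pose B := [set w : {ffun W -> L} | e W H w y].
have AB : (#|A| * #|{: {ffun W -> L}}| = #|B| * #|{: {ffun V -> L}}|)%N.
  rewrite -(cardsT {ffun W -> L}) -(cardsT {ffun V -> L}) [RHS]mulnC -!cardsX.
  rewrite -(card_imset _ (inv_inj swK)); apply: eq_card => p.
  have -> : (p \in [set sw q | q in setX A setT]) = (sw p \in setX A setT).
    apply/imsetP/idP => [[q qA ->]|pA]; first by rewrite swK.
    by exists (sw p) => //; rewrite swK.
  rewrite !in_setX !inE andbT /=; apply: (le _ _ _ _ _ _ _ _ h h').
  have hh' := local_iso_sym hh; split; split.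
  - exact: (local_iso_root hh).
  - move=> u uB; split; [exact: (local_iso_in hh)|exact: (local_isoK hh)| |].
      by rewrite ffunE uB.
    by move=> v vB; exact: (local_iso_adj hh).
  - exact: (local_iso_root hh').
  - move=> u uB; split; [exact: (local_iso_in hh')|exact: (local_isoK hh')| |].
      by rewrite ffunE (local_iso_in hh' uB) (local_isoK hh' uB).
    by move=> v vB; exact: (local_iso_adj hh').
apply/eqP; rewrite eqr_div ?pnatr_eq0 -?lt0n ?labellings_gt0 //.
by rewrite -!natrM AB.
Qed.

Lemma exists_le_average (T : finType) (g : T -> F) (c : F) : (0 < #|T|)%N ->
  \sum_t g t <= #|T|%:R * c -> exists t, g t <= c.
Proof.
move=> T0; apply: contraPP => /forallNP ng; apply/negP; rewrite -ltNge.
rewrite mulr_natl -sumr_const; have /card_gt0P[t _] := T0.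
apply: ltr_sum; last by move=> i _; rewrite ltNge; apply/negP; apply: ng.
by apply/hasP; exists t => //; rewrite mem_index_enum.
Qed.

(** The squared deviations summed over [I] have average at most the bound; a labelling not above it
    controls every term, all being nonnegative. Balls of radius [R] meet only if their centres are
    within [R + R]. *)
Lemma exists_typical_labelling (I : finType) (e : I -> event L) (V : finType)
    (G : sgraph V) (M : nat) :
  (forall i, local_event R (e i)) ->
  (forall x, #|gball G (R + R) x| <= M)%N ->
  exists w : {ffun V -> L}, forall i,
    (ehits (e i) G w - \sum_x eprob (e i) G x) ^+ 2 <= (#|I| * (#|V| * M))%:R.
Proof.
move=> le GM.
have disj x : (#|[set z | ~~ [disjoint gball G R x & gball G R z]]| <= M)%N.
  apply: leq_trans (GM x); apply/subset_leq_card/subsetP => z; rewrite in_set.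
  move=> /pred0Pn[u /andP[/= ux uz]].
  exact: gball_trans ux (gball_symI uz).
have [w ww] : exists w : {ffun V -> L},
    \sum_i (ehits (e i) G w - \sum_x eprob (e i) G x) ^+ 2
      <= (#|I| * (#|V| * M))%:R.
  apply: exists_le_average; first exact: labellings_gt0.
  rewrite exchange_big /= -natrM mulnCA -[X in (X * _)%N]sum1_card big_distrl.
  rewrite natr_sum /=; apply: ler_sum => i _; rewrite mul1n.
  apply: second_moment disj (labellings_gt0 V) => x.
  exact: local_event_depends.
exists w => i; apply: le_trans ww; rewrite (bigD1 i) //= lerDl.
by apply: sumr_ge0 => j _; apply: sqr_ge0.
Qed.

End LocalEvents.

(** Bridge from rooted induced subgraphs to maps between whole vertex sets; outside the balls
    [insub] fails and the root is the default value. *)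
Lemma rooted_iso_local (G H : fsgraph) (R : nat) (x : vertex G) (y : vertex H) :
  rooted_iso (rooted_ball R x) (rooted_ball R y) <->
  exists h h', local_iso G H (fun=> tt) (fun=> tt) R x y h h'.
Proof.
have half : forall (G H : fsgraph) (x : vertex G) (y : vertex H)
    (g : {u | u \in gball G R x} -> {u | u \in gball H R y})
    (g' : {u | u \in gball H R y} -> {u | u \in gball G R x}),
    cancel g g' -> (forall u v, adj H (val (g u)) (val (g v)) = adj G (val u) (val v)) ->
    val (g (exist _ x (gball_root G R x))) = y ->
    half_iso G H (fun=> tt) (fun=> tt) R x y
      (fun u => oapp (fun s => val (g s)) y (insub u))
      (fun u => oapp (fun s => val (g' s)) x (insub u)).
  move=> {}G {}H {}x {}y {}g {}g' {}gK {}gadj {}groot; split.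
    rewrite (insubT (fun z => z \in gball G R x) (gball_root G R x)) /= -[RHS]groot.
    by congr (val (g _)); apply: val_inj.
  move=> u uB; rewrite (insubT (fun z => z \in gball G R x) uB) /=; split=> //.
  - exact: valP.
  - by rewrite valK /= gK.
  - by move=> v vB; rewrite (insubT (fun z => z \in gball G R x) vB) /= gadj.
split=> [[g [g' gK g'K] [gadj groot]]|[h [h' hh]]].
  do 2!eexists; split; first by apply: (half _ _ _ _ _ _ gK gadj); rewrite groot.
  apply: (half _ _ _ _ _ _ g'K) => [u v|].
    by have := gadj (g' u) (g' v); rewrite !g'K => /esym.
  by have := gK (exist _ x (gball_root G R x)); rewrite groot => ->.
exists (fun s => exist _ (h (val s)) (local_iso_in hh (valP s))).
  exists (fun s => exist _ (h' (val s)) (local_iso_in (local_iso_sym hh) (valP s))).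
    by move=> [s sB]; apply: val_inj; rewrite /= (local_isoK hh).
  by move=> [s sB]; apply: val_inj; rewrite /= (local_isoK (local_iso_sym hh)).
split; last by apply: val_inj; rewrite /= (local_iso_root hh).
by move=> [u uB] [v vB]; rewrite /= (local_iso_adj hh).
Qed.

Import numFieldNormedType.Exports.
Local Open Scope classical_set_scope.
Local Open Scope ring_scope.

(** * Weakly convergent sequences *)

Lemma rooted_ball_U (d R : nat) (G : fsgraph) (x : vertex G) :
  Graph_d d G -> U_rd R d (rooted_ball R x).
Proof.
move=> Gd; set B := rooted_ball R x.
(* A walk of length at most [R] from [x] stays in the ball, so distances from the root do not grow
   in the induced graph. *)
have inB r (u : vertex B) : (r <= R)%N -> val u \in gball G r x ->
    u \in gball B r (groot B).
  elim: r u => [|r IH] u rR; first by rewrite !gball0.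
  case/gballS => [ux|[z zx zu]]; apply/gballS; first by left; apply: IH => //; apply: ltnW.
  have zR : z \in gball G R x by apply: gball_mono zx; apply: ltnW.
  by right; exists (exist _ z zR) => //; apply: IH => //; apply: ltnW.
have rooted u : connect (adj B) (groot B) u.
  have /gballP[p [_ pp pl]] := inB R u (leqnn R) (valP u).
  by apply/connectP; exists p.
split.
- move=> u v; apply: connect_trans (rooted v).
  by rewrite sym_connect_sym; [exact: rooted|exact: adj_sym].
- move=> u; apply: leq_trans (Gd (val u)); rewrite /degree.
  rewrite -(card_imset _ val_inj); apply/subset_leq_card/subsetP => _ /imsetP[v + ->].
  by rewrite !inE.
- by move=> u; apply: inB => //; apply: valP.
Qed.

Section Limits.
Variables (F : realType) (L : finType) (d D R : nat) (G : nat -> fsgraph).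
Hypothesis L0 : (0 < #|L|)%N.
Hypothesis R1 : (1 <= R)%N.
Hypothesis Gcvg : weakly_convergent F d G.
Hypothesis GD : forall n (x : vertex (G n)), (#|gball (G n) R x| <= D)%N.

(** By [eprob_local] the probability depends only on the unlabelled ball type, so the mean is a
    fixed finite combination of type frequencies, which converge by weak convergence. *)
Lemma mean_cvg (e : event L) : local_event R e ->
  cvg ((\sum_x eprob F e (G n) x) / #|vertex (G n)|%:R @[n --> \oo]).
Proof.
move=> le; have [Gd _ Gp] := Gcvg.
pose c n x := ball_canon (L := unit) D R (G n) (fun=> tt) x.
have ciso n m (x : vertex (G n)) (y : vertex (G m)) : c n x = c m y <->
    exists h h', local_iso (G n) (G m) (fun=> tt) (fun=> tt) R x y h h'.
  by apply: ball_canonP; apply: GD.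
(* [p k] is the common probability of the event on balls of type [k], and 0 for a type that never
   occurs in the sequence. *)
have /choice[p pP] : forall k : option (ball_code unit D), exists q : F,
    forall n x, c n x = k -> eprob F e (G n) x = q.
  move=> k; have [[m [y <-]]|nk] := pselect (exists m y, c m y = k); last first.
    by exists 0 => n x cx; exfalso; apply: nk; exists n, x.
  exists (eprob F e (G m) y) => n x /ciso[h [h' hh]].
  exact: eprob_local hh.
have fcvg k : cvg ((#|[set x | c n x == k]%SET|%:R / #|vertex (G n)|%:R : F) @[n --> \oo]).
  have [[m [y <-]]|nk] := pselect (exists m y, c m y = k); last first.
    rewrite (_ : (fun n => _) = fun=> 0); first exact: is_cvg_cst.
    apply/funext => n; rewrite (_ : [set x | _]%SET = finset.set0) ?cards0 ?mul0r //.
    apply/setP => x; rewrite !inE; apply/negP => /eqP cx.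
    by apply: nk; exists n, x.
  rewrite (_ : (fun n => _) = fun n => p_stat F (G n) R (rooted_ball R y)).
    exact: Gp R1 (@rooted_ball_U d R _ y (Gd m)).
  apply/funext => n; rewrite /p_stat; congr (_%:R / _).
  apply: eq_card => x; rewrite !inE; apply/eqP/asboolP.
    by move=> /ciso/rooted_iso_local.
  by move=> /rooted_iso_local/ciso.
rewrite (_ : (fun n => _) =
  fun n => \sum_k p k * (#|[set x | c n x == k]%SET|%:R / #|vertex (G n)|%:R)).
  apply/cvg_ex; eexists; apply: cvg_big; first exact: add_continuous.
  by move=> k _; apply: cvgM (cvg_cst _) (fcvg k).
apply/funext => n; under [RHS]eq_bigr => k _ do rewrite mulrA.
rewrite -[RHS]mulr_suml; congr (_ / _).
rewrite (partition_big (c n) predT) //=; apply: eq_bigr => k _.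
under eq_bigr => x /eqP cx do rewrite (pP _ _ _ cx).
by rewrite sumr_const mulr_natr cardsE.
Qed.

Variable D2 : nat.
Hypothesis GD2 : forall n (x : vertex (G n)), (#|gball (G n) (R + R) x| <= D2)%N.

(** Half of [eta] pays for the distance from the frequency to its mean, half for the distance from
    the mean to its limit. *)
Lemma typical_labelling (I : finType) (e : I -> event L) :
  (forall i, local_event R (e i)) ->
  forall eta : F, 0 < eta ->
  \forall n \near \oo, exists w : {ffun vertex (G n) -> L}, forall i,
    `|ehits F (e i) (G n) w / #|vertex (G n)|%:R -
      lim ((\sum_x eprob F (e i) (G m) x) / #|vertex (G m)|%:R @[m --> \oo])| <= eta.
Proof.
move=> le eta eta0; have [_ Ginf _] := Gcvg.
have eta2 : 0 < eta / 2 by rewrite divr_gt0.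
(* With this many vertices the second moment bound is at most the square of [eta / 2] times the
   order of the graph. *)
have big : \forall n \near \oo,
    (#|I| * D2)%:R / (eta / 2) ^+ 2 <= #|vertex (G n)|%:R :> F.
  have [N NP] : exists N : nat, (#|I| * D2)%:R / (eta / 2) ^+ 2 <= N%:R :> F.
    exists (Num.bound ((#|I| * D2)%:R / (eta / 2) ^+ 2)).
    by rewrite ltW // archi_boundP // divr_ge0 // exprn_ge0 // ltW.
  move/cvgnyPge: Ginf => /(_ N); apply: filterS => n nN.
  by apply: le_trans NP _; rewrite ler_nat.
have pos : \forall n \near \oo, (0 < #|vertex (G n)|)%N.
  by move/cvgnyPge: Ginf => /(_ 1%N).
have near_lim : \forall n \near \oo, forall i,
    `|(\sum_x eprob F (e i) (G n) x) / #|vertex (G n)|%:R -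
      lim ((\sum_x eprob F (e i) (G m) x) / #|vertex (G m)|%:R @[m --> \oo])| <= eta / 2.
  apply: filter_forall => i.
  have /cvgrPdist_le/(_ _ eta2) := mean_cvg (le i).
  by apply: filterS => n; rewrite distrC.
near=> n.
have n0 : (0 < #|vertex (G n)|)%N by near: n.
have n0' : 0 < #|vertex (G n)|%:R :> F by rewrite ltr0n.
have [w wP] := exists_typical_labelling F L0 le (@GD2 n).
exists w => i; rewrite -(subrKA ((\sum_x eprob F (e i) (G n) x) / #|vertex (G n)|%:R)).
apply: le_trans (ler_normD _ _) _; rewrite [X in _ <= X](splitr eta) lerD //; last first.
  by move: i; near: n.
rewrite -mulrBl normrM [`|_^-1|]gtr0_norm ?invr_gt0 // ler_pdivrMr //.
have rhs0 : 0 <= eta / 2 * #|vertex (G n)|%:R by rewrite mulr_ge0 // ltW.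
rewrite -(@ler_pXn2r _ 2) ?nnegrE //.
rewrite real_normK ?num_real // exprMn.
apply: le_trans (wP i) _; rewrite mulnCA natrM mulrC expr2 mulrA ler_pM2r //.
rewrite -expr2 mulrC -ler_pdivrMr ?exprn_gt0 //; near: n.
exact: big.
Unshelve. all: by end_near. Qed.

End Limits.

(** * Growth and convergence of sequences *)

Lemma bernoulli (F : realFieldType) (t : F) n : 0 <= t -> 1 + n%:R * t <= (1 + t) ^+ n.
Proof.
move=> t0; elim: n => [|n IH]; first by rewrite mul0r addr0 expr0.
rewrite exprS; apply: le_trans (_ : (1 + t) * (1 + n%:R * t) <= _); last first.
  by rewrite ler_wpM2l // addr_ge0.
rewrite [X in _ <= X]mulrDl mul1r -natr1 mulrDl mul1r addrA lerD2l.
by rewrite ler_peMr // lerDl mulr_ge0.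
Qed.

(** With [delta = 1 / (2m)] the left side is at most [C (m + 1/2) ^ r], which [(m + 1) ^ r]
    eventually overtakes. *)
Lemma subexponential_growth (F : realType) (f : nat -> nat) (m : nat) :
  subexponential F f -> (0 < m)%N ->
  exists2 r, (0 < r)%N & (m ^ r * f r < m.+1 ^ r)%N.
Proof.
move=> hf m0; have m0' : 0 < m%:R :> F by rewrite ltr0n.
pose delta : F := (2 * m%:R)^-1; have d0 : 0 < delta by rewrite invr_gt0 mulr_gt0.
have [C C0 fC] := hf delta d0.
have mE : m%:R * (1 + delta) = m%:R + 2^-1 :> F.
  by rewrite mulrDr mulr1 /delta invfM mulrCA mulfV ?gt_eqF // mulr1.
have mp : 0 < m%:R + 2^-1 :> F by rewrite addr_gt0.
(* [1 + t] is the ratio of [m + 1] to [m + 1/2]; by [bernoulli] its [r]-th power exceeds [C] once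
   [r] is above [C / t]. *)
pose t : F := 2^-1 / (m%:R + 2^-1); have t0 : 0 < t by rewrite divr_gt0.
have tE : (m%:R + 2^-1) * (1 + t) = m.+1%:R.
  have half2 : 2^-1 + 2^-1 = 1 :> F by rewrite -[2^-1]mul1r -splitr.
  by rewrite mulrDr mulr1 /t mulrC divfK ?gt_eqF // -addrA half2 natr1.
pose r := (Num.bound (C / t)).+1.
have Cr : C < (1 + t) ^+ r.
  apply: lt_le_trans (bernoulli r (ltW t0)).
  have : C / t < r%:R.
    apply: lt_trans (archi_boundP _) _; first by rewrite divr_ge0 // ltW.
    by rewrite ltr_nat.
  rewrite ltr_pdivrMr // => /lt_le_trans; apply.
  by rewrite lerDr.
exists r => //; rewrite -(ltr_nat F) natrM !natrX.
apply: le_lt_trans (_ : m%:R ^+ r * (C * (1 + delta) ^+ r) < _).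
  by rewrite ler_wpM2l ?exprn_ge0 // fC.
by rewrite mulrCA -exprMn mE -tE exprMn mulrC ltr_pM2l // exprn_gt0.
Qed.

(** The limit is [sup E], the lower limit. If almost all [a k] exceeded [sup E + e / 2], that number
    would belong to [E]; so some [k] satisfying the hypothesis for [e / 2] has a smaller [a k],
    which bounds all late terms. *)
Lemma nearly_decreasing_cvg (F : realType) (a : nat -> F) :
  (forall n, 0 <= a n) ->
  (forall e, 0 < e -> \forall k \near \oo, \forall n \near \oo, a n <= a k + e) ->
  cvg (a n @[n --> \oo]).
Proof.
move=> a0 adec; pose E := [set y | \forall n \near \oo, y <= a n].
have supE : has_sup E.
  split; first by exists 0; apply: nearW.
  have [k kP] := filter_ex (adec 1 ltr01); exists (a k + 1) => y yE.
  by have [n [yn /(le_trans yn)]] := filter_ex (filterI yE kP).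
apply/cvg_ex; exists (sup E); apply/cvgrPdist_le => e e0.
have e2 : 0 < e / 2 by rewrite divr_gt0.
have lower : \forall n \near \oo, sup E - e <= a n.
  have [y yE ly] := sup_adherent e0 supE.
  by apply: filterS yE => n; apply: le_trans; apply: ltW.
have upper : \forall n \near \oo, a n <= sup E + e.
  have [k [kP ak]] : exists k, (\forall n \near \oo, a n <= a k + e / 2) /\
      a k <= sup E + e / 2.
    apply: contrapT => /forallNP nk.
    have : E (sup E + e / 2).
      apply: filterS (adec _ e2) => k kP; rewrite leNgt; apply/negP => ak.
      by apply: (nk k); split=> //; apply: ltW.
    by move/(sup_upper_bound supE); apply/negP; rewrite -ltNge ltrDl.
  apply: filterS kP => n /le_trans; apply.
  by rewrite [X in sup E + X](splitr e) addrA lerD2r.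
near=> n; rewrite ler_distlC; apply/andP; split.
  by near: n.
by near: n.
Unshelve. all: by end_near. Qed.

(** * The probability of a conflict *)

Section Conflict.
Variables (F : realType) (N r D : nat) (V : finType) (G : sgraph V).

Definition conf_event : event 'I_N := fun V G a x => conf G a r x.

(** Relabelling [y] arbitrarily in a labelling with [w y = w x] loses no information, since the old
    label of [y] can still be read at [x]. *)
Lemma same_label_card (x y : V) : x != y ->
  (#|[set w : {ffun V -> 'I_N} | w y == w x]%SET| * N <= #|{: {ffun V -> 'I_N}}|)%N.
Proof.
move=> xy; rewrite -[X in (_ * X)%N]card_ord -[X in (_ * X)%N]cardsT -cardsX.
pose upd (p : {ffun V -> 'I_N} * 'I_N) : {ffun V -> 'I_N} :=
  [ffun z => if z == y then p.2 else p.1 z].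
rewrite -(card_in_imset (f := upd)); first exact: max_card.
move=> [w c] [w' c']; rewrite !in_setX !inE !andbT /= => /eqP wxy /eqP wxy' /ffunP e.
have off z : z != y -> w z = w' z.
  by move=> zy; have := e z; rewrite !ffunE (negPf zy).
congr pair; last by have := e y; rewrite !ffunE eqxx.
apply/ffunP => z; case: (eqVneq z y) => [->|]; last exact: off.
by rewrite wxy wxy' off.
Qed.

(** Union bound over the ball: each other vertex shares the label of [x] with probability at most
    [1 / N]. *)
Lemma eprob_conf (x : V) : (0 < N)%N -> (#|gball G (2 * r) x| <= D)%N ->
  eprob F conf_event G x <= D%:R / N%:R.
Proof.
move=> N0 xD; rewrite /eprob /prob ler_pdivrMr; last first.
  by rewrite ltr0n labellings_gt0 // card_ord.
rewrite mulrAC ler_pdivlMr ?ltr0n // -!natrM ler_nat.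
pose S y := [set w : {ffun V -> 'I_N} | w y == w x]%SET.
apply: leq_trans (_ : (\sum_(y in gball G (2 * r) x | y != x) #|S y|) * N <= _)%N.
  rewrite leq_mul2r; apply/orP; right; apply: leq_trans (card_bigcup_le _ _).
  apply/subset_leq_card/subsetP => w; rewrite inE => /existsP[y /and3P[yB yx wy]].
  by apply/bigcupP; exists y; rewrite ?yB ?yx ?inE.
rewrite big_distrl /=.
apply: leq_trans (_ : \sum_(y in gball G (2 * r) x) #|{: {ffun V -> 'I_N}}| <= _)%N.
  rewrite big_mkcondr /=; apply: leq_sum => y _; case: ifP => // yx.
  by apply: same_label_card; rewrite eq_sym yx.
by rewrite sum_nat_const leq_mul2r xD orbT.
Qed.

End Conflict.

(** * The edit distance *)

Section EditDistance.
Variables (F : realType) (d : nat) (P : fsgraph -> Prop).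
Hypothesis hP : union_closed_monotone d P.

Lemma edit_dist_ge0 (V : finType) (G H : sgraph V) : 0 <= edit_dist F G H.
Proof. by rewrite divr_ge0. Qed.

Lemma edit_dist_to_le (G : fsgraph) (H : sgraph (vertex G)) :
  P (FSGraph H) -> edit_dist_to F P G <= edit_dist F G H.
Proof.
move=> PH; apply: ge_inf; last by exists H.
by exists 0 => _ [K _ <-]; apply: edit_dist_ge0.
Qed.

(** Bounding [inf] from below requires a nonempty set of competitors; the edgeless graph is one. *)
Lemma edit_dist_to_ge (G : fsgraph) (c : F) :
  (forall H : sgraph (vertex G), P (FSGraph H) -> c <= edit_dist F G H) ->
  c <= edit_dist_to F P G.
Proof.
move=> cH; apply: lb_le_inf; last by move=> _ [H PH <-]; apply: cH.
have sym0 : symmetric (fun _ _ : vertex G => false) by [].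
have irr0 : irreflexive (fun _ _ : vertex G => false) by [].
exists (edit_dist F G (SGraph sym0 irr0)), (SGraph sym0 irr0) => //.
exact: (edgeless_P hP).
Qed.

Lemma edges_spread (T V : finType) (K : sgraph T) (phi : T -> V)
    (phi_inj : injective phi) :
  edges (spread K phi_inj) = [set [set phi z | z in (E : {set T})] | E in edges K]%SET.
Proof.
apply/setP => E; apply/edgesP/imsetP.
  case=> x [y [/spread_adjP[p [p' [-> -> pp']]] ->]].
  by exists [set p; p']%SET; rewrite ?mem_edges // imsetU !imset_set1.
case=> _ /edgesP[p [p' [pp' ->]]] ->; exists (phi p), (phi p').
by rewrite imsetU !imset_set1; split=> //; apply/spread_adjP; exists p, p'.
Qed.

(** A competitor for [G] is pushed forward along [h], which does not enlarge the symmetric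
    difference. *)
Lemma edit_dist_to_iso_le (G H : fsgraph) :
  graph_iso G H -> edit_dist_to F P H <= edit_dist_to F P G.
Proof.
case=> h hbij hadj; have h_inj := bij_inj hbij.
case: G h hbij hadj h_inj => V G; case: H => W H /= h hbij hadj h_inj.
apply: edit_dist_to_ge => K PK.
apply: le_trans (edit_dist_to_le (G := FSGraph H) (spread_P hP h_inj PK)) _.
have HE : edges H = edges (spread G h_inj).
  apply/setP => E; apply/edgesP/edgesP => -[x [y [xy ->]]].
    have [h' _ h'K] := hbij; exists x, y; split=> //; apply/spread_adjP.
    by exists (h' x), (h' y); rewrite !h'K -hadj !h'K.
  by case/spread_adjP: xy => p [p' [-> -> pp']]; exists (h p), (h p'); rewrite hadj.
rewrite /edit_dist (bij_eq_card hbij) ler_wpM2r ?invr_ge0 // ler_nat HE !edges_spread.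
have sub (T S : finType) (A B : {set T}) (g : T -> S) :
    (g @: A :\: g @: B \subset g @: (A :\: B))%SET.
  apply/subsetP => _ /setDP[/imsetP[x xA ->] gx]; apply: imset_f.
  by rewrite in_setD xA andbT; apply: contra gx; apply: imset_f.
apply: leq_trans (leq_imset_card _ _); rewrite imsetU.
by apply/subset_leq_card/setUSS; apply: sub.
Qed.

Lemma edit_dist_to_parameter : graph_parameter (edit_dist_to F P).
Proof.
move=> G H GH; apply/le_anti/andP; split; apply: edit_dist_to_iso_le => //.
case: GH => h [h' hK h'K] hadj; exists h'; first by exists h.
by move=> x y; rewrite -hadj !h'K.
Qed.

End EditDistance.

(** Comparing frequencies gives [x <= y * v / w + 2 * eta * v], and rounding [v / w] down to
    [v %/ w] costs at most one further [y]. *)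
Lemma surplus_bound (F : realFieldType) (x y v w : nat) (mu eta : F) :
  (0 < v)%N -> (0 < w)%N ->
  `|x%:R / v%:R - mu| <= eta -> `|y%:R / w%:R - mu| <= eta ->
  (x - (v %/ w) * y)%N%:R <= y%:R + 2 * eta * v%:R.
Proof.
move=> v0 w0 xmu ymu; have v0' : 0 < v%:R :> F by rewrite ltr0n.
have w0' : 0 < w%:R :> F by rewrite ltr0n.
have eta0 : 0 <= eta by apply: le_trans xmu.
have rhs0 : 0 <= 2 * eta * v%:R by rewrite !mulr_ge0 // ltW.
case: (leqP x ((v %/ w) * y)) => xy.
  by move: xy; rewrite -subn_eq0 => /eqP ->; rewrite addr_ge0.
rewrite natrB ?(ltnW xy) // lerBlDr.
have xv : x%:R <= y%:R / w%:R * v%:R + 2 * eta * v%:R.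
  rewrite -mulrDl -ler_pdivrMr // -lerBlDl.
  rewrite -(subrKA mu); apply: le_trans (ler_norm _) _.
  apply: le_trans (ler_normD _ _) _.
  by rewrite [2 * _]mulr_natl mulr2n lerD // distrC.
apply: le_trans xv _; rewrite [_ + _ + (_)%:R]addrAC lerD2r mulrAC ler_pdivrMr //.
rewrite -natrD -!natrM ler_nat -[X in (X + _)%N]mul1n -mulnDl add1n mulnAC mulnC.
by rewrite leq_mul2r ltnW ?orbT // ltn_ceil.
Qed.

(** * Comparison of two terms of the sequence *)

Section Comparison.
Variables (F : realType) (d : nat) (f : nat -> nat) (P : fsgraph -> Prop).
Hypotheses (d0 : (0 < d)%N) (hf : subexponential F f) (hP : union_closed_monotone d P).
Variable G : nat -> fsgraph.
Hypotheses (Gdf : forall n, Graph_df d f (G n)) (Gcvg : weakly_convergent F d G).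

(** Constants are fixed in the order [m], [r], [N], [R], [eta], then [k], then [n]. Typical
    labellings of [G k] and [G n] feed [cell_matching], and [transfer] turns a competitor for [G k]
    into one for [G n]. *)
Lemma edit_dist_to_nearly_decreasing e : 0 < e ->
  \forall k \near \oo, \forall n \near \oo,
    edit_dist_to F P (G n) <= edit_dist_to F P (G k) + e.
Proof.
move=> e0; have d0' : 0 < d%:R :> F by rewrite ltr0n.
have gf n (x : vertex (G n)) r : (0 < r)%N -> (#|gball (G n) r x| <= f r)%N.
  by move=> r0; have [_ ->] := Gdf n.
(* Three shares of [e1] go to the layers, to the mean proportion of conflicts, and to sampling
   errors with unmatched cells; each bad vertex costs at most [d] edges. *)
have [e1 e10 e1E] : exists2 e1 : F, 0 < e1 & d%:R * 3 * e1 = e.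
  exists (e / (d%:R * 3)); first by rewrite divr_gt0 // mulr_gt0.
  by rewrite mulrC divfK // gt_eqF // mulr_gt0.
pose m := (Num.bound e1^-1).+1.
have me : m%:R^-1 <= e1.
  rewrite invf_ple ?posrE ?ltr0n // ltW //.
  apply: lt_trans (archi_boundP _) _; first by rewrite invr_ge0 ltW.
  by rewrite ltr_nat.
have [r r0 growth] := subexponential_growth (m := m) hf isT.
pose N := (Num.bound ((f (2 * r))%:R / e1)).+1.
have Ne : (f (2 * r))%:R / N%:R <= e1.
  rewrite ler_pdivrMr ?ltr0n // mulrC -ler_pdivrMr // ltW //.
  apply: lt_trans (archi_boundP _) _; first by rewrite divr_ge0 // ltW.
  by rewrite ltr_nat.
pose R := (3 * r * N.+1)%N; have R0 : (0 < R)%N by rewrite !muln_gt0 r0.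
have rR : (2 * r <= R)%N.
  by apply: leq_trans (leq_pmulr _ _); rewrite ?leq_mul2r ?orbT.
pose D := f R.
pose K : finType := option (ball_code 'I_N D).
(* [None] is the conflict event and [Some c] the event of having ball type [c], where [c] is itself
   an option. *)
pose ev (i : option K) : event 'I_N := match i with
  | None => conf_event (N := N) r
  | Some c => fun V H a x => ball_canon D R H a x == c end.
have ev_local i : local_event R (ev i).
  move=> V W H H' a b x y h h' hh; case: i => [c|] /=.
    by rewrite (ball_canon_local D hh).
  rewrite /conf_event -(local_iso_root hh); apply/esym.
  by apply: (conf_local (t := 0) hh); rewrite ?gball0.
(* The multiples of [eta] in the bound on [Bad]: one from the conflicts, the rest from the unmatched
   cells. *)
pose c1 : F := 1 + D%:R * (1 + 2 * #|K|%:R).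
have c10 : 0 < c1 by rewrite ltr_pwDl // mulr_ge0 // addr_ge0 // mulr_ge0.
have [eta eta0 etaE] : exists2 eta, 0 < eta & eta * c1 = e1.
  by exists (e1 / c1); [rewrite divr_gt0|rewrite divfK // gt_eqF].
have L0 : (0 < #|'I_N|)%N by rewrite card_ord.
have RR0 : (0 < R + R)%N by rewrite addn_gt0 R0.
have typ := typical_labelling L0 R0 Gcvg (fun n x => @gf n x R R0)
  (fun n x => @gf n x (R + R)%N RR0) ev_local eta0.
set mu := fun i : option K => lim ((\sum_x eprob F (ev i) (G m) x) /
   #|vertex (G m)|%:R @[m --> \oo]).
have Ginf : #|vertex (G n)| @[n --> \oo] --> \oo by case: Gcvg.
have pos : \forall n \near \oo, (0 < #|vertex (G n)|)%N.
  by move/cvgnyPge: Ginf => /(_ 1%N).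
have mu_conf : mu None <= e1.
  apply: limr_le.
    exact: (mean_cvg L0 R0 Gcvg (fun n x => @gf n x R R0) (ev_local None)).
  apply: filterS pos => n n0; rewrite ler_pdivrMr ?ltr0n //.
  rewrite mulr_natr -sumr_const; apply: ler_sum => x _.
  apply: le_trans Ne; apply: eprob_conf => //.
  by apply: gf; rewrite muln_gt0.
near=> k.
have k0 : (0 < #|vertex (G k)|)%N by near: k.
have [b bP] : exists w : {ffun vertex (G k) -> 'I_N}, forall i : option K,
    `|ehits F (ev i) (G k) w / #|vertex (G k)|%:R - mu i| <= eta by near: k.
(* Rounding in [q] leaves up to [#|vertex (G k)|] vertices uncovered; for large [n] this is a
   proportion at most [eta] of [G n]. *)
have wide : \forall n \near \oo, #|vertex (G k)|%:R <= eta * #|vertex (G n)|%:R.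
  pose M := Num.bound (#|vertex (G k)|%:R / eta).
  move/cvgnyPge: Ginf => /(_ M); apply: filterS => n nM.
  rewrite mulrC -ler_pdivrMr //; apply: (@le_trans _ _ M%:R); last by rewrite ler_nat.
  by rewrite ltW // archi_boundP // divr_ge0 // ltW.
near=> n.
have n0 : (0 < #|vertex (G n)|)%N by near: n.
have [a aP] : exists w : {ffun vertex (G n) -> 'I_N}, forall i : option K,
    `|ehits F (ev i) (G n) w / #|vertex (G n)|%:R - mu i| <= eta by near: n.
have kn : #|vertex (G k)|%:R <= eta * #|vertex (G n)|%:R by near: n.
rewrite -lerBlDr; apply: (edit_dist_to_ge hP) => H PH.
set q := (#|vertex (G n)| %/ #|vertex (G k)|)%N.
have growth' x : (m ^ r * #|gball (G n) r x| < m.+1 ^ r)%N.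
  by apply: leq_ltn_trans growth; rewrite leq_mul2l gf ?orbT.
have [phi [Bad [phi_inj phiB BadB]]] :=
  cell_matching a b (leqnn R) (fun x => @gf n x R R0) (fun x => @gf k x R R0)
    growth' (leq_trunc_div #|vertex (G n)| #|vertex (G k)| : q * _ <= _)%N.
have Gd : forall x, (degree (G n) x <= d)%N by have [] := Gdf n.
have [HA [PHA HAB]] := transfer hP PH phi_inj Gd phiB.
set v := #|vertex (G n)| in n0 kn q phi phi_inj phiB BadB HAB *.
set w := #|vertex (G k)| in k0 kn q phi phi_inj phiB BadB HAB *.
have v0 : 0 < v%:R :> F by rewrite ltr0n.
have w0 : 0 < w%:R :> F by rewrite ltr0n.
move: BadB; set conf_n := #|[set x | conf _ _ _ x]%SET|; set S := (\sum_c _)%N => BadB.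
have conf_le : conf_n%:R <= (e1 + eta) * v%:R.
  rewrite -ler_pdivrMr // -lerBlDl; apply: le_trans (aP None).
  by apply: le_trans (ler_norm _); rewrite lerB.
(* Over all types the terms [y] of [surplus_bound] add up to [w], which is at most [eta * v]. *)
have S_le : S%:R <= (1 + 2 * #|K|%:R) * eta * v%:R.
  rewrite natr_sum; apply: le_trans (ler_sum _ _) _ => [c _|].
    exact: surplus_bound n0 k0 (aP (Some c)) (bP (Some c)).
  rewrite big_split /= sumr_const -natr_sum.
  have -> : (\sum_c #|[set y | ball_canon D R (G k) b y == c]%SET| = w)%N.
    rewrite /w -sum1_card (partition_big (ball_canon D R (G k) b) predT) //=.
    by apply: eq_bigr => c _; rewrite sum1dep_card.
  rewrite -[X in _ <= X]mulrA [X in _ <= X]mulrDl mul1r lerD //.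
  by rewrite -[X in X <= _]mulr_natr -[2 * eta * _]mulrA mulrAC.
have Bad_le : #|Bad|%:R <= 3 * e1 * v%:R.
  have m0 : 0 < m%:R :> F by rewrite ltr0n.
  have : m%:R * #|Bad|%:R <= v%:R + m%:R * conf_n%:R + m%:R * (D%:R * S%:R) :> F.
    by rewrite -!natrM -!natrD ler_nat.
  rewrite -addrA -mulrDr mulrC -ler_pdivlMr // => /le_trans; apply.
  rewrite mulrDl [_ * _ / _]mulrAC mulfV ?gt_eqF // mul1r.
  apply: (@le_trans _ _ (e1 * v%:R +
      ((e1 + eta) * v%:R + D%:R * ((1 + 2 * #|K|%:R) * eta * v%:R)))).
    by rewrite lerD ?lerD ?ler_wpM2l // mulrC ler_wpM2r.
  rewrite [D%:R * _]mulrA [D%:R * _]mulrA -!mulrDl ler_pM2r // -!addrA.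
  have -> : eta + D%:R * (1 + 2 * #|K|%:R) * eta = e1.
    by rewrite -[X in X + _]mul1r -mulrDl mulrC.
  by rewrite [3 * e1]mulr_natl !mulrS addr0.
rewrite lerBlDr; apply: le_trans (edit_dist_to_le F (G := G n) PHA) _.
rewrite /edit_dist ler_pdivrMr // mulrDl.
move: HAB; rewrite -(ler_nat F) natrD !natrM => /le_trans; apply.
apply: lerD.
  (* As [q * w <= v], the normalised cost of [q] copies is at most that of [G k] alone. *)
  rewrite mulrAC ler_pdivlMr // -!natrM ler_nat mulnAC mulnC leq_mul2l.
  by rewrite leq_trunc_div orbT.
apply: le_trans (ler_wpM2l (ltW d0') Bad_le) _.
by rewrite mulrA mulrA e1E.
Unshelve. all: by end_near. Qed.

End Comparison.

Theorem theorem2 (R : realType) (d : nat) (f : nat -> nat) (P : fsgraph -> Prop)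
  (hd : (2 <= d)%N) (hf : subexponential R f)
  (hP : union_closed_monotone d P) :
  continuous_parameter d f (edit_dist_to R P).
Proof.
split=> [|G Gdf Gcvg]; first exact: edit_dist_to_parameter hP.
apply: nearly_decreasing_cvg => [n|e e0].
  by apply: (edit_dist_to_ge hP) => H _; apply: edit_dist_ge0.
exact: (edit_dist_to_nearly_decreasing (ltnW hd) hf hP Gdf Gcvg e0).
Qed.
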